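(* Let $\mathcal{P}$ be an arithmetic polygon with $N$ sides, and let $\mu(\mathcal{P})$ denote the number of interior angles of $\mathcal{P}$ that are greater than $\pi$. For any $\nu$, if $\mu(\mathcal{P})\le\nu$ then $N\le 8+3\pi^2(\nu+2)^2$.
   Context: An arithmetic polygon is a (closed) polygon in the plane with integer side lengths and a distinguished vertex $O$ satisfying: (1) as one traverses the polygon starting and finishing at $O$, each side has length exactly one greater than the length of the side preceding it; (2) for each side of the polygon, there is a line perpendicular to that side which passes through both $O$ and one of the two endpoints of that side; (3) no vertex is degenerate, i.e., no vertex has an angle of $0$ or $\pi$ radians. Interior angles are the angles of the polygon at its vertices measured on the interior side of the polygon. *)

(* Defs.v *)
From mathcomp Require Import all_boot all_order all_algebra.
From mathcomp Require Import all_classical all_reals all_analysis.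

Set Implicit Arguments.
Unset Strict Implicit.
Unset Printing Implicit Defensive.

Import Order.TTheory GRing.Theory Num.Theory.
Import numFieldNormedType.Exports.

Local Open Scope classical_set_scope.
Local Open Scope ring_scope.

Section Plane.
Variable R : realType.
Implicit Types p q d : R * R.

(* The library norm on [R * R] is the sup norm, hence the Euclidean one here. *)
Definition dot p q : R := p.1 * q.1 + p.2 * q.2.

Definition enorm p : R := Num.sqrt (dot p p).

Definition line p d : set (R * R) := [set p + t *: d | t in [set: R]].

Definition angle p q : R := acos (dot p q / (enorm p * enorm q)).

End Plane.

Section Polygon.
Variables (R : realType) (N : nat).
Implicit Types (v : 'I_N -> R * R) (i o : 'I_N).

(* A polygon is given by the cyclic sequence of its vertices [v]; [ordS] and
   [ord_pred] are the cyclic successor and predecessor on ['I_N], and the side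
   of index [i] goes from [v i] to [v (ordS i)]. *)
Definition side_vector v i : R * R := v (ordS i) - v i.

Definition side_length v i : R := enorm (side_vector v i).

Definition side_point v i (t : R) : R * R := v i + t *: side_vector v i.

Definition boundary v : set (R * R) :=
  [set p | exists i, exists2 t : R, 0 <= t <= 1 & p = side_point v i t].

(* The closed polygonal curve has no self-intersection. In particular sides
   have nonzero length, vertices are distinct, and [2 < N] (unless [N = 0]). *)
Definition simple_polygon v : Prop :=
  forall i j (s t : R), 0 <= s < 1 -> 0 <= t < 1 ->
    side_point v i s = side_point v j t -> i = j /\ s = t.

(* Points lying in a bounded component of the complement of the boundary. The
   first condition is needed: [connected_component A p] is empty, hence
   bounded, when [p] is not in [A]. *)
Definition polygon_interior v : set (R * R) :=
  [set p | ~ boundary v p /\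
           bounded_set (connected_component (~` boundary v) p)].

(* Directions, as polar angles, in which one enters the interior from [v i]. *)
Definition inward_directions v i : set R :=
  [set a | 0 <= a < 2 * pi /\
           \forall r \near 0^'+, polygon_interior v (v i + r *: (cos a, sin a))].

(* The radian measure of the angle at [v i] on the interior side; it ranges
   over the whole of ]0, 2 * pi[, unlike [angle]. *)
Definition interior_angle v i : R :=
  fine (lebesgue_measure (inward_directions v i)).

Definition num_reflex v : nat := #|[pred i | pi < interior_angle v i]|.

(* The angle in [0, pi] between the two sides at [v i]; it is [0] or [pi]
   exactly when these sides are collinear. *)
Definition vertex_angle v i : R :=
  angle (v (ord_pred i) - v i) (v (ordS i) - v i).

(* There is a line orthogonal to the side [i] through [v o] and [v k]. *)
Definition perp_line_through v o i k : Prop :=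
  exists p d, [/\ d != 0, dot d (side_vector v i) = 0,
                  line p d (v o) & line p d (v k)].

(* [o] is the index of the distinguished vertex, from which the traversal
   starts: the side that begins at [v o] has no preceding side. *)
Definition arithmetic_polygon v o : Prop :=
  [/\ simple_polygon v,
      forall i, side_length v i \is a Num.int,
      forall i, ordS i != o -> side_length v (ordS i) = side_length v i + 1,
      forall i, perp_line_through v o i i \/ perp_line_through v o i (ordS i)
    & forall i, vertex_angle v i != 0 /\ vertex_angle v i != pi].

End Polygon.

(* Main.v *)
Require Import Defs.
From mathcomp Require Import all_boot all_order all_algebra.
From mathcomp Require Import all_classical all_reals all_analysis.
From mathcomp Require Import ring lra zify.

Set Implicit Arguments.
Unset Strict Implicit.
Unset Printing Implicit Defensive.

Import Order.TTheory GRing.Theory Num.Theory.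
Import numFieldNormedType.Exports.

Local Open Scope classical_set_scope.
Local Open Scope ring_scope.

(** Put the distinguished vertex at the origin. Condition (2) says that each
    side forms a right angle with the position vector of one of its ends, so
    along a side the distance to the origin is monotone. A decreasing side is
    never followed by an increasing one, since both would be perpendicular to
    the same position vector and the vertex between them would be degenerate.
    So the polygon consists of two arms on which the distance to the origin
    increases, from the origin to a farthest vertex. In polar coordinates they
    are graphs [theta = alpha r] and [theta = beta r] with [alpha = beta] at the
    farthest vertex and, the polygon being simple, [beta - alpha] never in
    [2 * pi * Z] before that. By the intermediate value theorem
    [0 < beta - alpha < 2 * pi], up to exchanging the arms, the interior is the
    region between the graphs, and each side of the lower arm that turns
    clockwise about the origin, as well as each side of the upper arm that turns
    counterclockwise, has a reflex angle at its nearer end. Hence the angles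
    under which the sides are seen from the origin, which are at most [pi / 2],
    add up to at most [2 * pi + pi * mu]. On the other hand the first arm
    contains more than half of the sides, and its [k]-th side is seen under an
    angle at least [atan (1 / sqrt k)]. *)

(** * Polar coordinates in the plane and two estimates for the arctangent *)

Section Plane.
Variable R : realType.
Implicit Types (p q : R * R) (a b c r t x y : R).

Definition dir a : R * R := (cos a, sin a).

Definition perp p : R * R := (- p.2, p.1).

Definition cross p q : R := p.1 * q.2 - p.2 * q.1.

Lemma dot_ge0 p : 0 <= dot p p.
Proof. by rewrite /dot addr_ge0// -expr2 sqr_ge0. Qed.

Lemma dot_eq0 p : (dot p p == 0) = (p == 0).
Proof.
case: p => x y; rewrite /dot /= -!expr2 paddr_eq0 ?sqr_ge0// !sqrf_eq0.
by rewrite -pair_eqE.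
Qed.

Lemma dot_gt0 p : p != 0 -> 0 < dot p p.
Proof. by move=> p0; rewrite lt_neqAle eq_sym dot_eq0 p0 dot_ge0. Qed.

Lemma enorm_ge0 p : 0 <= enorm p. Proof. exact: sqrtr_ge0. Qed.

Lemma enorm_sqr p : enorm p ^+ 2 = dot p p.
Proof. by rewrite sqr_sqrtr// dot_ge0. Qed.

Lemma enorm_gt0 p : p != 0 -> 0 < enorm p.
Proof. by move=> p0; rewrite sqrtr_gt0 dot_gt0. Qed.

Lemma enorm0 : enorm (0 : R * R) = 0.
Proof. by rewrite /enorm /dot /= mul0r addr0 sqrtr0. Qed.

Lemma enorm_dir r a : 0 <= r -> enorm (r *: dir a) = r.
Proof.
move=> r0; rewrite /enorm /dot /=.
have -> : r * cos a * (r * cos a) + r * sin a * (r * sin a) =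
  r ^+ 2 * (cos a ^+ 2 + sin a ^+ 2) by ring.
by rewrite cos2Dsin2 mulr1 sqrtr_sqr ger0_norm.
Qed.

Lemma enorm_ge_coord p : (`|p.1| <= enorm p) * (`|p.2| <= enorm p).
Proof.
by split; rewrite -sqrtr_sqr ler_wsqrtr// /dot -!expr2 ?lerDl ?lerDr sqr_ge0.
Qed.

Lemma dirD a b : dir (a + b) = cos b *: dir a + sin b *: perp (dir a).
Proof.
by rewrite /dir cosD sinD /perp; congr pair => /=; rewrite /GRing.scale/=; ring.
Qed.

Lemma dirDE a b :
  dir (a + b) = (cos a * cos b - sin a * sin b, sin a * cos b + cos a * sin b).
Proof. by rewrite /dir cosD sinD. Qed.

Lemma dir2pi a : dir (a + 2 * pi) = dir a.
Proof. by rewrite /dir mulrDl mul1r -mulr2n cosD2pi sinD2pi. Qed.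

Lemma sin_atan x : sin (atan x) = x / Num.sqrt (1 + x ^+ 2).
Proof.
have := atanK x; rewrite /tan => /(canRL (divfK _)) ->.
  by rewrite cos_atan.
by rewrite cos_atan invr_neq0// gt_eqF// sqrtr_gt0 ltr_pwDl// sqr_ge0.
Qed.

(** For [r > 0] this is a right triangle with legs [r] and [r * |c|]: the move along the tangent
    stretches the vector by the ratio of hypotenuse to leg and rotates it by [atan c]. *)
Lemma add_perp_dir r a c :
  r *: dir a + c *: perp (r *: dir a) =
  (r * Num.sqrt (1 + c ^+ 2)) *: dir (a + atan c).
Proof.
have s0 : Num.sqrt (1 + c ^+ 2) != 0.
  by rewrite gt_eqF// sqrtr_gt0 ltr_pwDl// sqr_ge0.
rewrite dirDE cos_atan sin_atan /dir /perp.
by congr pair; rewrite /= /GRing.scale/=; field.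
Qed.

Lemma polar_exists p : exists2 a, 0 <= a < 2 * pi & p = enorm p *: dir a.
Proof.
have pi0 := pi_gt0 R.
have [->|p0] := eqVneq p 0.
  exists 0; first by rewrite lexx mulr_gt0.
  by rewrite enorm0 scale0r.
have e0 := enorm_gt0 p0.
have /eqP := enorm_sqr p; rewrite /dot => /eqP es.
pose x := p.1 / enorm p.
have xb : -1 <= x <= 1.
  have := (enorm_ge_coord p).1; rewrite ler_norml => /andP[l1 l2].
  by rewrite ler_pdivlMr// ler_pdivrMr// mulN1r mul1r l1.
have ax0 := acos_ge0 xb; have ax1 := acos_lepi xb.
have sE : sin (acos x) = `|p.2| / enorm p.
  rewrite sin_acos// -[RHS]ger0_norm ?divr_ge0 ?enorm_ge0// -sqrtr_sqr; congr Num.sqrt.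
  rewrite /x !expr_div_n real_normK ?num_real//.
  apply/(mulIf (lt0r_neq0 (exprn_gt0 2 e0))).
  by rewrite mulrBl !mulfVK ?expf_neq0 ?gt_eqF// es; ring.
have cE : cos (acos x) = x by rewrite acosK// in_itv.
have [y0|y0] := leP 0 p.2.
  exists (acos x); first by rewrite ax0/=; lra.
  rewrite /dir cE sE ger0_norm// /x [LHS]surjective_pairing.
  by congr pair; rewrite /GRing.scale/= mulrC divfK// gt_eqF.
(* The ordinate is nonzero here, so the angle is too; this keeps [2 * pi - acos x] strictly below
   [2 * pi]. *)
have ax00 : acos x != 0.
  apply/eqP => a0; move: sE; rewrite a0 sin0 => /esym/eqP.
  by rewrite mulf_eq0 normr_eq0 invr_eq0 (gt_eqF e0) (lt_eqF y0).
exists (2 * pi - acos x).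
  have ax00' : 0 < acos x by rewrite lt_neqAle eq_sym ax00.
  by apply/andP; split; lra.
have -> : dir (2 * pi - acos x) = dir (- acos x) by rewrite addrC dir2pi.
rewrite /dir cosN sinN cE sE ltr0_norm// /x [LHS]surjective_pairing.
by congr pair; rewrite /GRing.scale/= ?mulNr ?opprK mulrC divfK// gt_eqF.
Qed.

Lemma MVT_atan x y : x < y -> exists2 c, x < c < y &
  atan y - atan x = (1 + c ^+ 2)^-1 * (y - x).
Proof.
move=> xy.
have drv z : z \in `]x, y[ -> is_derive z 1 (@atan R) (1 + z ^+ 2)^-1.
  by move=> _; exact: is_derive1_atan.
have ctn : {within `[x, y], continuous (@atan R)}.
  by apply: continuous_subspaceT => z; exact: continuous_atan.
by have [c] := MVT xy drv ctn; rewrite in_itv/= => cI h; exists c.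
Qed.

Lemma atan_lipschitz x y : x <= y -> atan y - atan x <= y - x.
Proof.
rewrite le_eqVlt => /predU1P[->|xy]; first by rewrite !subrr.
have [c _ ->] := MVT_atan xy.
by rewrite ler_piMl ?subr_ge0 ?(ltW xy)// invf_le1 ?ltr_pwDl ?lerDl ?sqr_ge0.
Qed.

(** By the mean value theorem, since the derivative of [atan] on [[0, x]] is at least its value
    [1 / (1 + x ^ 2)] at the right end. *)
Lemma le_atan_div x : 0 <= x -> x / (1 + x ^+ 2) <= atan x.
Proof.
rewrite le_eqVlt => /predU1P[<-|x0]; first by rewrite mul0r atan0.
have [c /andP[c0 cx]] := MVT_atan x0; rewrite atan0 !subr0 => ->.
rewrite mulrC ler_wpM2r ?(ltW x0)// lef_pV2 ?posrE ?ltr_pwDl ?sqr_ge0//.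
by rewrite lerD2l ler_sqr ?nnegrE ltW.
Qed.

End Plane.

(** * The polar angle along one side, as a function of the distance to the origin *)

Section Swing.
Variable R : realType.
Implicit Types (c r t x : R).

(* The polar angle, relative to [v], of the point at distance [x] from the
   origin on the segment from [v] to [v + c *: perp v], where [r] is the norm
   of [v]; it is constant outside the range of distances of the segment. *)
Definition swing c r x : R :=
  atan (Num.sg c * Num.sqrt (Num.min (Num.max 0 (x ^+ 2 / r ^+ 2 - 1)) (c ^+ 2))).

Lemma swing_le c r x : 0 < r -> 0 <= x <= r -> swing c r x = 0.
Proof.
move=> r0 /andP[x0 xr]; rewrite /swing max_l.
  by rewrite min_l ?sqr_ge0// sqrtr0 mulr0 atan0.
by rewrite subr_le0 ler_pdivrMr ?exprn_gt0// mul1r ler_sqr ?nnegrE// ltW.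
Qed.

Lemma swing_mid c r t : 0 < r -> 0 <= t <= 1 ->
  swing c r (r * Num.sqrt (1 + (t * c) ^+ 2)) = atan (t * c).
Proof.
move=> r0 /andP[t0 t1]; rewrite /swing exprMn sqr_sqrtr; last first.
  by rewrite addr_ge0// sqr_ge0.
rewrite mulrAC divff ?mul1r ?expf_neq0 ?gt_eqF// addrAC subrr add0r.
rewrite max_r ?sqr_ge0// min_l; last first.
  by rewrite exprMn ler_piMl ?sqr_ge0// expr_le1.
by rewrite sqrtr_sqr normrM ger0_norm// mulrCA -numEsg.
Qed.

Lemma swing_ge c r x : 0 < r -> r * Num.sqrt (1 + c ^+ 2) <= x ->
  swing c r x = atan c.
Proof.
move=> r0 rx; rewrite /swing min_r; last first.
  rewrite le_max; apply/orP; right.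
  rewrite lerBrDl ler_pdivlMr ?exprn_gt0// mulrC.
  rewrite -[leLHS]sqr_sqrtr; last first.
    by rewrite mulr_ge0 ?sqr_ge0// addr_ge0// sqr_ge0.
  have h : 0 <= r * Num.sqrt (1 + c ^+ 2) by rewrite mulr_ge0 ?sqrtr_ge0 ?ltW.
  rewrite sqrtrM ?sqr_ge0// sqrtr_sqr gtr0_norm// ler_sqr ?nnegrE//.
  exact: le_trans rx.
by rewrite sqrtr_sqr -numEsg.
Qed.

Lemma swing_exists c r x : 0 < r -> c != 0 ->
  r <= x <= r * Num.sqrt (1 + c ^+ 2) ->
  exists2 t, 0 <= t <= 1 & x = r * Num.sqrt (1 + (t * c) ^+ 2).
Proof.
move=> r0 c0 /andP[rx xr].
have x0 : 0 <= x by rewrite (le_trans _ rx)// ltW.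
have q0 : 0 <= x ^+ 2 / r ^+ 2 - 1.
  by rewrite subr_ge0 ler_pdivlMr ?exprn_gt0// mul1r ler_sqr ?nnegrE// ltW.
have q1 : x ^+ 2 / r ^+ 2 - 1 <= c ^+ 2.
  rewrite lerBlDl ler_pdivrMr ?exprn_gt0// mulrC.
  rewrite -[1 + _]sqr_sqrtr -?exprMn ?addr_ge0 ?sqr_ge0//.
  by rewrite ler_sqr ?nnegrE// mulr_ge0 ?sqrtr_ge0 ?ltW.
have nc : 0 < `|c| by rewrite normr_gt0.
exists (Num.sqrt (x ^+ 2 / r ^+ 2 - 1) / `|c|).
  rewrite divr_ge0 ?sqrtr_ge0//= ler_pdivrMr// mul1r.
  by rewrite -sqrtr_sqr ler_wsqrtr.
have -> : (Num.sqrt (x ^+ 2 / r ^+ 2 - 1) / `|c| * c) ^+ 2 = x ^+ 2 / r ^+ 2 - 1.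
  rewrite !exprMn exprVn real_normK ?num_real// divfK ?expf_neq0//.
  by rewrite sqr_sqrtr.
rewrite [1 + _]addrC subrK -expr_div_n sqrtr_sqr ger0_norm ?divr_ge0 ?(ltW r0)//.
by rewrite mulrC divfK// gt_eqF.
Qed.

Lemma swing_mid_sg c r x : 0 < r -> r <= x <= r * Num.sqrt (1 + c ^+ 2) ->
  swing c r x = Num.sg c * atan (Num.sqrt (x ^+ 2 / r ^+ 2 - 1)).
Proof.
move=> r0 /andP[rx xr].
have x0 : 0 <= x by rewrite (le_trans _ rx)// ltW.
have q0 : 0 <= x ^+ 2 / r ^+ 2 - 1.
  by rewrite subr_ge0 ler_pdivlMr ?exprn_gt0// mul1r ler_sqr ?nnegrE// ltW.
have q1 : x ^+ 2 / r ^+ 2 - 1 <= c ^+ 2.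
  rewrite lerBlDl ler_pdivrMr ?exprn_gt0// mulrC.
  rewrite -[1 + _]sqr_sqrtr -?exprMn ?addr_ge0 ?sqr_ge0//.
  by rewrite ler_sqr ?nnegrE// mulr_ge0 ?sqrtr_ge0 ?ltW.
rewrite /swing max_r// min_l//; case: sgrP => _.
- by rewrite !mul0r atan0.
- by rewrite !mul1r.
- by rewrite !mulN1r atanN.
Qed.

(** At its near end the side is tangent to a circle about the origin and the angle grows like a
    square root; at its far end the side crosses the circle transversally, which allows a bound
    linear in the squared distance. Writing [x] through the parameter [t] and using that [atan] is
    1-Lipschitz, it reduces to [t * (1 - t) >= 0]. *)
Lemma swing_lipschitz_top c r x : 0 < r -> c != 0 ->
  r <= x <= r * Num.sqrt (1 + c ^+ 2) ->
  `|swing c r x - atan c| <=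
    (r ^+ 2 * `|c|)^-1 * ((r * Num.sqrt (1 + c ^+ 2)) ^+ 2 - x ^+ 2).
Proof.
move=> r0 c0 xI; have nc : 0 < `|c| by rewrite normr_gt0.
have [t /andP[t0 t1] ->] := swing_exists r0 c0 xI.
rewrite swing_mid ?t0//.
have -> : `|atan (t * c) - atan c| = atan `|c| - atan (t * `|c|).
  have h : atan (t * `|c|) <= atan `|c| by rewrite le_atan// ler_piMl.
  have [c1|c1] := ltP 0 c.
    by rewrite gtr0_norm// in h *; rewrite ler0_norm ?opprB// subr_le0.
  rewrite ler0_norm// in h *; rewrite mulrN !atanN in h *.
  by rewrite ger0_norm ?subr_ge0; lra.
apply: (le_trans (atan_lipschitz _)); first by rewrite ler_piMl.
have s (y : R) : Num.sqrt (1 + y ^+ 2) ^+ 2 = 1 + y ^+ 2.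
  by rewrite sqr_sqrtr// addr_ge0// sqr_ge0.
rewrite !(exprMn _ r) !s exprMn.
rewrite [leRHS]mulrC ler_pdivlMr ?mulr_gt0 ?exprn_gt0// -[c ^+ 2]real_normK ?num_real//.
set d := `|c| in nc *.
rewrite -subr_ge0.
have -> : r ^+ 2 * (1 + d ^+ 2) - r ^+ 2 * (1 + t ^+ 2 * d ^+ 2) -
   (d - t * d) * (r ^+ 2 * d) = r ^+ 2 * d ^+ 2 * (t * (1 - t)) by ring.
by rewrite !mulr_ge0 ?sqr_ge0 ?subr_ge0//; exact: ltW.
Qed.

Lemma continuous_swing c r : continuous (swing c r).
Proof.
pose f x := Num.min (Num.max 0 (x ^+ 2 / r ^+ 2 - 1)) (c ^+ 2).
have cf : continuous f.
  move=> x; apply: (@continuous_min R R (fun y => Num.max 0 (y ^+ 2 / r ^+ 2 - 1)));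
    last exact: cvg_cst.
  apply: (@continuous_max R R (fun=> 0)); first exact: cvg_cst.
  apply: cvgB; last exact: cvg_cst.
  by apply: cvgM; [exact: exprn_continuous|exact: cvg_cst].
move=> x; apply: (@continuous_comp _ _ _ (fun y => Num.sg c * Num.sqrt (f y)) (@atan R)).
  apply: cvgM; first exact: cvg_cst.
  by apply: (@continuous_comp _ _ _ f (@Num.sqrt R)); [exact: cf|exact: sqrt_continuous].
exact: continuous_atan.
Qed.

End Swing.

(** * Arms as graphs in polar coordinates *)

Section Arm.
Variable R : realType.
Implicit Types (Q : nat -> R * R) (n k : nat) (phi r t x : R).

(* One of the two halves into which the farthest vertex cuts the polygon, run
   from the distinguished vertex (at the origin) outwards: each side is
   perpendicular to the position vector of its nearer end. *)
Definition arm Q n : Prop :=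
  [/\ Q 0%N = 0, (0 < n)%N &
      forall k, (k < n)%N -> dot (Q k) (Q k.+1 - Q k) = 0 /\ Q k.+1 != Q k].

(** The tangent of the signed angle under which side [k] is seen from the origin. It is meaningful
    for [k > 0] only: side [0] is radial, so the sums below start at [1]. *)
Definition slope Q k : R := cross (Q k) (Q k.+1) / dot (Q k) (Q k).

Definition arm_turn Q n : R := \sum_(1 <= k < n) atan (slope Q k).

(* The polar angle of the point of the arm at distance [x] from the origin. *)
Definition arm_angle Q phi n x : R :=
  phi + \sum_(1 <= k < n) swing (slope Q k) (enorm (Q k)) x.

Section ArmTheory.
Variables (Q : nat -> R * R) (n : nat).
Hypothesis armQ : arm Q n.

Let Q0 : Q 0%N = 0. Proof. by case: armQ. Qed.
Let n0 : (0 < n)%N. Proof. by case: armQ. Qed.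

Lemma arm_pythagoras k : (k < n)%N ->
  dot (Q k.+1) (Q k.+1) =
  dot (Q k) (Q k) + dot (Q k.+1 - Q k) (Q k.+1 - Q k).
Proof.
case: armQ => _ _ /[apply] -[+ _]; rewrite /dot.
by case: (Q k) (Q k.+1) => x y [z w] /= d; lra.
Qed.

Lemma arm_norm_lt k : (k < n)%N -> enorm (Q k) < enorm (Q k.+1).
Proof.
move=> kn; have [_ _ /(_ _ kn)[_ d]] := armQ.
rewrite /enorm ltr_sqrt; last first.
  by rewrite arm_pythagoras// ltr_wpDl ?dot_ge0// dot_gt0// subr_eq0.
by rewrite arm_pythagoras// ltrDl dot_gt0// subr_eq0.
Qed.

Lemma arm_norm_le j k : (j <= k <= n)%N -> enorm (Q j) <= enorm (Q k).
Proof.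
move=> /andP[]; elim: k => [|k IH]; first by rewrite leqn0 => /eqP->.
rewrite leq_eqVlt => /predU1P[->//|]; rewrite ltnS => jk kn.
by rewrite (le_trans (IH jk (ltnW kn)))// ltW// arm_norm_lt.
Qed.

Lemma arm_norm_gt0 k : (0 < k <= n)%N -> 0 < enorm (Q k).
Proof.
move=> /andP[k0 kn]; apply: (@lt_le_trans _ _ (enorm (Q 1%N))).
  by rewrite (le_lt_trans _ (arm_norm_lt n0))// enorm_ge0.
by rewrite arm_norm_le ?k0.
Qed.

Lemma arm_step k : (0 < k < n)%N -> Q k.+1 = Q k + slope Q k *: perp (Q k).
Proof.
move=> /andP[k0 kn]; have [_ _ /(_ _ kn)[d _]] := armQ.
have := @arm_norm_gt0 k; rewrite k0 (ltnW kn) => /(_ isT).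
rewrite sqrtr_gt0 /slope /cross; move: d; rewrite /perp /dot.
case: (Q k) (Q k.+1) => x y [z w] /= d p.
have p0 : x * x + y * y != 0 by rewrite gt_eqF.
congr pair; rewrite /GRing.scale/= /GRing.scale/=; apply: (mulfI p0).
  transitivity (x * (x * x + y * y) - y * (x * w - y * z)); last by field.
  by apply/eqP; rewrite -subr_eq0 -(mulr0 x) -d; apply/eqP; ring.
transitivity (y * (x * x + y * y) + x * (x * w - y * z)); last by field.
by apply/eqP; rewrite -subr_eq0 -(mulr0 y) -d; apply/eqP; ring.
Qed.

Lemma slope_neq0 k : (0 < k < n)%N -> slope Q k != 0.
Proof.
move=> kI; apply/eqP => s0; have := arm_step kI; rewrite s0 scale0r addr0 => e.
by case/andP: kI => _ kn; have [_ _ /(_ _ kn)[_]] := armQ; rewrite e eqxx.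
Qed.

Lemma slope_norm k : (0 < k < n)%N ->
  enorm (Q k.+1 - Q k) = `|slope Q k| * enorm (Q k).
Proof.
move=> kI; rewrite arm_step// addrAC subrr add0r /enorm.
set c := slope _ _.
have -> : dot (c *: perp (Q k)) (c *: perp (Q k)) = c ^+ 2 * dot (Q k) (Q k).
  by rewrite /dot /perp /GRing.scale/= /GRing.scale/=; ring.
by rewrite sqrtrM ?sqr_ge0// sqrtr_sqr.
Qed.

Lemma arm_norm_step k : (0 < k < n)%N ->
  enorm (Q k.+1) = enorm (Q k) * Num.sqrt (1 + slope Q k ^+ 2).
Proof.
move=> kI; rewrite -[LHS]ger0_norm ?enorm_ge0// -[LHS]sqrtr_sqr enorm_sqr.
rewrite arm_pythagoras; last by case/andP: kI.
rewrite -!enorm_sqr (slope_norm kI) exprMn real_normK ?num_real//.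
rewrite -{1}[_ ^+ 2]mul1r -mulrDl mulrC sqrtrM ?sqr_ge0// sqrtr_sqr.
by rewrite ger0_norm// enorm_ge0.
Qed.

Section Angle.
Variable phi : R.
Hypothesis Q1 : Q 1%N = enorm (Q 1%N) *: dir phi.

Lemma arm_turnS k : (0 < k)%N -> arm_turn Q k.+1 = arm_turn Q k + atan (slope Q k).
Proof. by move=> k0; rewrite /arm_turn big_nat_recr. Qed.

Lemma arm_vertex k : (0 < k <= n)%N ->
  Q k = enorm (Q k) *: dir (phi + arm_turn Q k).
Proof.
case/andP; case: k => // k _; elim: k => [|k IH] kn.
  by rewrite /arm_turn big_geq// addr0.
have kI : (0 < k.+1 < n)%N by [].
rewrite {1}arm_step// {1 2}IH ?(ltnW kn)// add_perp_dir -arm_norm_step//.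
by rewrite (@arm_turnS k.+1)// addrA.
Qed.

(** At such a distance the sides before [k] have completed their swing, contributing [arm_turn Q k],
    and the sides after [k] have not begun theirs. *)
Lemma arm_angle_split k x : (0 < k < n)%N ->
  enorm (Q k) <= x <= enorm (Q k.+1) ->
  arm_angle Q phi n x = phi + arm_turn Q k + swing (slope Q k) (enorm (Q k)) x.
Proof.
move=> kI /andP[x1 x2]; have /andP[k0 kn] := kI.
rewrite /arm_angle (big_cat_nat (n := k))//=; last exact: ltnW.
rewrite (big_ltn kn) [X in _ + (_ + (_ + X))]big1_seq ?addr0; last first.
  move=> j /andP[_]; rewrite mem_index_iota => /andP[kj jn].
  rewrite swing_le ?arm_norm_gt0//; first by rewrite (leq_ltn_trans _ kj)//= ltnW.
  rewrite (le_trans (enorm_ge0 _) x1) (le_trans x2)// arm_norm_le// kj/=.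
  exact: ltnW.
rewrite addrA; congr (_ + _ + _); apply: eq_big_nat => j /andP[j0 jk].
have jn : (j < n)%N by exact: ltn_trans jk kn.
have r0 : 0 < enorm (Q j) by rewrite arm_norm_gt0// j0 ltnW.
rewrite swing_ge// -arm_norm_step ?j0//.
by rewrite (le_trans _ x1)// arm_norm_le// jk ltnW.
Qed.

Lemma arm_angle_before x : 0 <= x <= enorm (Q 1%N) -> arm_angle Q phi n x = phi.
Proof.
move=> /andP[x0 x1]; rewrite /arm_angle big1_seq ?addr0// => j.
rewrite mem_index_iota => /andP[_ /andP[j0 jn]].
have r0 : 0 < enorm (Q j) by rewrite arm_norm_gt0// j0 ltnW.
by rewrite swing_le// x0 (le_trans x1)// arm_norm_le// j0 ltnW.
Qed.

Lemma arm_angle_after x : enorm (Q n) <= x ->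
  arm_angle Q phi n x = phi + arm_turn Q n.
Proof.
move=> nx; rewrite /arm_angle /arm_turn; congr (_ + _).
apply: eq_big_nat => j /andP[j0 jn].
have r0 : 0 < enorm (Q j) by rewrite arm_norm_gt0// j0 ltnW.
rewrite swing_ge// -arm_norm_step ?j0//.
by rewrite (le_trans _ nx)// arm_norm_le// jn leqnn.
Qed.

Lemma arm_angle_vertex k : (0 < k <= n)%N ->
  arm_angle Q phi n (enorm (Q k)) = phi + arm_turn Q k.
Proof.
move=> /andP[k0]; rewrite leq_eqVlt => /predU1P[->|kn].
  by rewrite arm_angle_after.
rewrite (@arm_angle_split k) ?k0//; last by rewrite lexx ltW// arm_norm_lt.
have r0 : 0 < enorm (Q k) by rewrite arm_norm_gt0// k0 ltnW.
by rewrite swing_le ?addr0// lexx enorm_ge0.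
Qed.

Lemma arm_side_point k t : (0 < k < n)%N -> 0 <= t ->
  Q k + t *: (Q k.+1 - Q k) =
  (enorm (Q k) * Num.sqrt (1 + (t * slope Q k) ^+ 2)) *:
    dir (phi + arm_turn Q k + atan (t * slope Q k)).
Proof.
move=> kI t0; have /andP[k0 kn] := kI.
rewrite {1}arm_step// addrAC subrr add0r scalerA.
by rewrite {1 2}(@arm_vertex k) ?add_perp_dir// k0 ltnW.
Qed.

Lemma arm_side_polar k t : (k < n)%N -> 0 <= t <= 1 ->
  let X := Q k + t *: (Q k.+1 - Q k) in
  enorm X <= enorm (Q n) /\ X = enorm X *: dir (arm_angle Q phi n (enorm X)).
Proof.
move=> kn /andP[t0 t1] X.
have XE : enorm X <= enorm (Q k.+1).
  rewrite ler_wsqrtr// arm_pythagoras//.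
  have [_ _ /(_ _ kn)[+ _]] := armQ.
  have : dot X X = dot (Q k) (Q k) + 2 * t * dot (Q k) (Q k.+1 - Q k)
     + t ^+ 2 * dot (Q k.+1 - Q k) (Q k.+1 - Q k).
    by rewrite /X /dot /GRing.scale/= /GRing.scale/=; ring.
  move=> -> ->; rewrite mulr0 addr0 lerD2l ler_piMl ?dot_ge0//.
  by rewrite expr_le1.
split; first by rewrite (le_trans XE)// arm_norm_le// kn leqnn.
have [k0|k0] := posnP k.
  rewrite k0 in X XE *.
  have E : X = (t * enorm (Q 1%N)) *: dir phi.
    by rewrite /X Q0 add0r subr0 {1}Q1 scalerA.
  by rewrite arm_angle_before ?enorm_ge0// {2}E enorm_dir// mulr_ge0 ?enorm_ge0.
have kI : (0 < k < n)%N by rewrite k0.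
have r0 : 0 < enorm (Q k) by rewrite arm_norm_gt0// k0 ltnW.
have E := arm_side_point kI t0; rewrite -/X in E.
have nE : enorm X = enorm (Q k) * Num.sqrt (1 + (t * slope Q k) ^+ 2).
  by rewrite E enorm_dir// mulr_ge0 ?enorm_ge0 ?sqrtr_ge0.
rewrite (@arm_angle_split k)//; last first.
  rewrite XE andbT nE ler_peMr ?enorm_ge0//.
  by rewrite -[leLHS]sqrtr1 ler_wsqrtr// lerDl sqr_ge0.
by rewrite nE swing_mid// t0.
Qed.

Lemma arm_polar_side x : 0 <= x <= enorm (Q n) ->
  exists k t, [/\ (k < n)%N, 0 <= t <= 1 &
    x *: dir (arm_angle Q phi n x) = Q k + t *: (Q k.+1 - Q k)].
Proof.
move=> /andP[x0 xn].
have [x1|x1] := leP x (enorm (Q 1%N)).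
  have q1 : 0 < enorm (Q 1%N) by rewrite arm_norm_gt0.
  exists 0%N, (x / enorm (Q 1%N)); split=> //.
    by rewrite divr_ge0 ?enorm_ge0//= ler_pdivrMr// mul1r.
  rewrite arm_angle_before ?x0// Q0 add0r subr0 {2}Q1 scalerA divfK//.
  by rewrite gt_eqF.
have [k kI /andP[xk xk1]] : exists2 k, (0 < k < n)%N &
    enorm (Q k) <= x <= enorm (Q k.+1).
  (* The first vertex at distance at least [x] ends the side sought; its index is at least [2],
     since [x] exceeds the distance of the first vertex. *)
  have ex : exists k, x <= enorm (Q k) by exists n.
  have m1 := ex_minnP ex; case: m1 => -[|[|m]] xm mmin.
  - by move: xm; rewrite Q0 enorm0 leNgt (le_lt_trans _ x1)// enorm_ge0.
  - by move: xm; rewrite leNgt x1.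
  exists m.+1; first by rewrite /= (leq_trans _ (mmin _ xn)).
  by rewrite xm andbT leNgt; apply/negP => /ltW/mmin; rewrite ltnn.
have /andP[k0 kn] := kI.
have r0 : 0 < enorm (Q k) by rewrite arm_norm_gt0// k0 ltnW.
have [t tI xE] : exists2 t, 0 <= t <= 1 &
   x = enorm (Q k) * Num.sqrt (1 + (t * slope Q k) ^+ 2).
  by apply: swing_exists => //; [exact: slope_neq0|rewrite xk -arm_norm_step].
exists k, t; split=> //; rewrite (arm_angle_split kI) ?xk// arm_side_point//.
  by rewrite {2}xE swing_mid// xE.
by case/andP: tI.
Qed.

(** Only the sign of the slope enters: beyond vertex [k] the arm follows a tangent of the circle of
    radius [enorm (Q k)], and the arctangent is the angle between the tangent point and the point at
    distance [x]. *)
Lemma arm_angle_rise k x : (0 < k < n)%N ->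
  enorm (Q k) <= x <= enorm (Q k.+1) ->
  arm_angle Q phi n x = arm_angle Q phi n (enorm (Q k)) +
    Num.sg (slope Q k) * atan (Num.sqrt (x ^+ 2 / enorm (Q k) ^+ 2 - 1)).
Proof.
move=> kI xI; have /andP[k0 kn] := kI.
have r0 : 0 < enorm (Q k) by rewrite arm_norm_gt0// k0 ltnW.
rewrite (arm_angle_split kI)// arm_angle_vertex; last by rewrite k0 ltnW.
by rewrite swing_mid_sg// -arm_norm_step.
Qed.

(** The side arriving at vertex [k] crosses the circle through it transversally, so
    [swing_lipschitz_top] applies; for [k = 1] that side is radial and [K = 0] serves. *)
Lemma arm_angle_lipschitz k : (0 < k < n)%N ->
  exists2 K, 0 <= K & forall x, enorm (Q k.-1) <= x <= enorm (Q k) ->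
    `|arm_angle Q phi n x - arm_angle Q phi n (enorm (Q k))| <=
      K * (enorm (Q k) ^+ 2 - x ^+ 2).
Proof.
case: k => // -[|k] /andP[_ kn].
  exists 0 => // x /andP[x0 x1]; rewrite /= Q0 enorm0 in x0.
  by rewrite !arm_angle_before ?x0 ?enorm_ge0 ?lexx// subrr normr0 mul0r.
have kI : (0 < k.+1 < n)%N by rewrite /= ltnW.
have r0 : 0 < enorm (Q k.+1) by rewrite arm_norm_gt0//= ltnW// ltnW.
exists (enorm (Q k.+1) ^+ 2 * `|slope Q k.+1|)^-1.
  by rewrite invr_ge0 mulr_ge0// sqr_ge0.
move=> x xI; rewrite [X in _ - X]arm_angle_vertex ?(ltnW kn)//.
rewrite (arm_angle_split kI)// (@arm_turnS k.+1)// !addrA.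
have -> (a b c : R) : a + b - (a + c) = b - c by ring.
rewrite (@arm_norm_step k.+1)//; apply: swing_lipschitz_top => //.
  exact: slope_neq0.
by rewrite -arm_norm_step.
Qed.

End Angle.

End ArmTheory.

Lemma continuous_arm_angle Q phi n : continuous (arm_angle Q phi n).
Proof.
move=> x; rewrite /arm_angle; apply: cvgD; first exact: cvg_cst.
apply: (cvg_big (op := +%R)) => [|k _]; [exact: add_continuous|exact: continuous_swing].
Qed.

End Arm.

(** * The region between two polar graphs and its corners *)

Section Region.
Variable R : realType.
Implicit Types (lo up : R -> R) (p : R * R) (r t x a : R).

(* For [p] with polar angle [theta] and norm [r], this is [r] times
   [cos (theta - mid) - cos half], where [mid] and [half] are the midpoint and
   half the width of [lo r, up r]: it is positive when [theta] lies, modulo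
   [2 * pi], between [lo r] and [up r], and needs no choice of [theta]. *)
Definition region lo up p : R :=
  dot p (dir ((lo (enorm p) + up (enorm p)) / 2)) -
  enorm p * cos ((up (enorm p) - lo (enorm p)) / 2).

Lemma continuous_enorm : continuous (@enorm R).
Proof.
move=> p; apply: (@continuous_comp _ _ _ (fun q => dot q q) (@Num.sqrt R));
  last exact: sqrt_continuous.
by apply: cvgD; apply: cvgM; (exact: cvg_fst || exact: cvg_snd).
Qed.

Lemma continuous_region lo up : continuous lo -> continuous up ->
  continuous (region lo up).
Proof.
move=> cl cu p.
have cle : {for p, continuous (lo \o @enorm R)}.
  by apply: continuous_comp; [exact: continuous_enorm|exact: cl].
have cue : {for p, continuous (up \o @enorm R)}.
  by apply: continuous_comp; [exact: continuous_enorm|exact: cu].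
have cmid : {for p, continuous (fun q => (lo (enorm q) + up (enorm q)) / 2)}.
  by apply: cvgM; [exact: cvgD|exact: cvg_cst].
apply: cvgB; last first.
  apply: cvgM; first exact: continuous_enorm.
  apply: (@continuous_comp _ _ _ (fun q => (up (enorm q) - lo (enorm q)) / 2) (@cos R));
    last exact: continuous_cos.
  by apply: cvgM; [exact: cvgB|exact: cvg_cst].
pose mid q := (lo (enorm q) + up (enorm q)) / 2.
by apply: cvgD; apply: cvgM; [exact: cvg_fst|
  exact: (@continuous_comp _ _ _ mid (@cos R) _ cmid (@continuous_cos R _))|
  exact: cvg_snd|
  exact: (@continuous_comp _ _ _ mid (@sin R) _ cmid (@continuous_sin R _))].
Qed.

Lemma region_polar lo up r theta : 0 <= r ->
  region lo up (r *: dir theta) =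
  r * (cos (theta - (lo r + up r) / 2) - cos ((up r - lo r) / 2)).
Proof.
move=> r0; rewrite /region enorm_dir// cosB /dot /dir /GRing.scale/= /GRing.scale/=.
by ring.
Qed.

Lemma region_arc lo up r : 0 <= r ->
  region lo up (r *: dir (lo r)) = 0 /\ region lo up (r *: dir (up r)) = 0.
Proof.
move=> r0; rewrite !region_polar//.
have -> : lo r - (lo r + up r) / 2 = - ((up r - lo r) / 2) by field.
have -> : up r - (lo r + up r) / 2 = (up r - lo r) / 2 by field.
by rewrite cosN subrr mulr0.
Qed.

Lemma cos_eq_dir a x : cos a = cos x -> dir a = dir x \/ dir a = dir (- x).
Proof.
move=> e; have : sin a ^+ 2 == sin x ^+ 2 by rewrite !sin2cos2 e.
by rewrite eqf_sqr /dir cosN sinN e => /orP[]/eqP->; [left|right].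
Qed.

(** Equal cosines mean that the angle measured from the middle of the interval is plus or minus half
    its width, modulo [2 * pi]: the point is on one of the two arcs. *)
Lemma region_eq0 lo up p : region lo up p = 0 ->
  p = enorm p *: dir (lo (enorm p)) \/ p = enorm p *: dir (up (enorm p)).
Proof.
have [theta _ {1 2 5}->] := polar_exists p.
rewrite region_polar ?enorm_ge0// => /eqP.
rewrite mulf_eq0 => /orP[/eqP->|]; first by left; rewrite !scale0r.
rewrite subr_eq0 => /eqP/cos_eq_dir h.
set r := enorm p in h *; set m := (lo r + up r) / 2 in h.
have dD x y : dir (x - m) = dir y -> dir x = dir (y + m).
  by case=> ec es; rewrite -(subrK m x) !dirDE ec es.
by case: h => /dD ->; [right|left]; congr (_ *: dir _); rewrite /m; field.
Qed.

(** The angle is closer to the middle of the interval than half its width, which is at most [pi],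
    and cosine decreases on [[0, pi]]. *)
Lemma region_gt0 lo up r theta : 0 < r -> up r - lo r <= 2 * pi ->
  lo r < theta < up r -> 0 < region lo up (r *: dir theta).
Proof.
move=> r0 w /andP[l u]; rewrite region_polar ?ltW// mulr_gt0// subr_gt0.
rewrite -[X in _ < X]cos_norm.
have nle : `|theta - (lo r + up r) / 2| < (up r - lo r) / 2.
  by rewrite ltr_norml; apply/andP; split; lra.
have := normr_ge0 (theta - (lo r + up r) / 2) => n0.
by rewrite ltr_cos// in_itv/=; apply/andP; split; lra.
Qed.

Lemma region_gt0_lt lo up M p : (forall x, M <= x -> lo x = up x) ->
  0 < region lo up p -> enorm p < M.
Proof.
move=> eqM; have [theta _ {1}->] := polar_exists p.
rewrite region_polar ?enorm_ge0// => h; rewrite ltNge; apply/negP => /eqM e.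
move: h; rewrite e subrr mul0r cos0 ltNge => /negP; apply.
by rewrite mulr_ge0_le0 ?enorm_ge0// subr_le0 cos_le1.
Qed.

(** Reflection in the horizontal axis exchanges the two arcs, so that statements about the upper one
    follow from those about the lower one. *)
Lemma region_mirror lo up p :
  region (fun x => - up x) (fun x => - lo x) (p.1, - p.2) = region lo up p.
Proof.
have e : enorm (p.1, - p.2) = enorm p by rewrite /enorm /dot /= mulrNN.
rewrite /region e /dot /dir/=.
have -> : (- up (enorm p) - lo (enorm p)) / 2 = - ((lo (enorm p) + up (enorm p)) / 2).
  by field.
by rewrite cosN sinN mulrNN opprK [- _ + up _]addrC.
Qed.

(* At a point of the lower arc that it leaves clockwise along a tangent to the
   circle centred at the origin, the region occupies more than a half-plane of
   directions: the tangent side counts because the arc bends away at right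
   angles, and the excess [psi] because the arc arrives transversally. *)
Lemma region_lower_corner lo up r d K :
    continuous lo -> continuous up ->
    0 < r -> 0 < d -> 0 <= K -> 0 < up r - lo r < 2 * pi ->
    (forall x, r <= x <= r + d ->
       lo x <= lo r - atan (Num.sqrt (x ^+ 2 / r ^+ 2 - 1))) ->
    (forall x, r - d <= x <= r -> lo x <= lo r + K * (r ^+ 2 - x ^+ 2)) ->
  exists2 psi, 0 < psi < pi & forall a, - (pi / 2) < a < pi / 2 + psi ->
    \forall t \near 0^'+, 0 < region lo up (r *: dir (lo r) + t *: dir (lo r + a)).
Proof.
move=> clo cup r0 d0 K0 /andP[w0 w1] Hr Hl.
(* Chosen so that [tan b < kappa] implies [4 * K * r ^ 2 * sin b < cos b], the inequality that ends
   the proof. *)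
pose kappa := (4 * K * r ^+ 2 + 1)^-1.
have kap0 : 0 < kappa by rewrite invr_gt0 ltr_wpDl// mulr_ge0 ?sqr_ge0// mulr_ge0.
have pi0 := pi_gt0 R.
have psi0 : 0 < atan kappa by rewrite -(atan0 R) lt_atan.
have psi1 := atan_ltpi2 kappa.
exists (atan kappa); first by apply/andP; split=> //; lra.
move=> a /andP[a1 a2].
(* Coordinates of the moving point in the frame rotated by [lo r]; [rho] is its norm and [eta] its
   polar angle relative to [lo r]. *)
pose X t := r + t * cos a; pose Y t := t * sin a.
pose rho t := enorm (X t, Y t); pose eta t := atan (Y t / X t).
have cX : {for 0, continuous X}.
  by apply: cvgD; [exact: cvg_cst|apply: cvgM; [exact: cvg_id|exact: cvg_cst]].
have cY : {for 0, continuous Y}.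
  by apply: cvgM; [exact: cvg_id|exact: cvg_cst].
have X0 : X 0 = r by rewrite /X mul0r addr0.
have Y0 : Y 0 = 0 by rewrite /Y mul0r.
have crho : {for 0, continuous rho}.
  apply: (@continuous_comp _ _ _ (fun t => (X t, Y t)) (@enorm R));
    last exact: continuous_enorm.
  exact: (cvg_pair cX cY).
have rho0 : rho 0 = r.
  by rewrite /rho X0 Y0 /enorm /dot/= mulr0 addr0 -expr2 sqrtr_sqr gtr0_norm.
have ceta : {for 0, continuous eta}.
  apply: (@continuous_comp _ _ _ (fun t => Y t / X t) (@atan R));
    last exact: continuous_atan.
  apply: cvgM; first exact: cY.
  by apply: cvgV; [rewrite X0 gt_eqF|exact: cX].
have eta0 : eta 0 = 0 by rewrite /eta Y0 mul0r atan0.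
have cgap : {for 0, continuous (fun t => up (rho t) - lo r - eta t)}.
  apply: cvgB => //; apply: cvgB; last exact: cvg_cst.
  by apply: (@continuous_comp _ _ _ rho up) => //; exact: cup.
have cw : {for 0, continuous (fun t => up (rho t) - lo (rho t))}.
  by apply: cvgB; [apply: (@continuous_comp _ _ _ rho up) => //; exact: cup
                  |apply: (@continuous_comp _ _ _ rho lo) => //; exact: clo].
have atR (f : R -> R) : {for 0, continuous f} -> f t @[t --> 0^'+] --> f 0.
  by move=> cf; apply: cvg_at_right_filter.
near=> t.
have t0 : 0 < t by near: t; exact: nbhs_right_gt.
have Xt : 0 < X t by near: t; apply: (cvgr_gt _ (atR _ cX)); rewrite X0.
have Yt : Y t < r by near: t; apply: (cvgr_lt _ (atR _ cY)); rewrite Y0.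
have rt1 : r - d < rho t.
  by near: t; apply: (cvgr_gt _ (atR _ crho)); rewrite rho0; lra.
have rt2 : rho t < r + d.
  by near: t; apply: (cvgr_lt _ (atR _ crho)); rewrite rho0; lra.
have wt : up (rho t) - lo (rho t) < 2 * pi.
  by near: t; apply: (cvgr_lt _ (atR _ cw)); rewrite rho0.
have gt : 0 < up (rho t) - lo r - eta t.
  by near: t; apply: (cvgr_gt _ (atR _ cgap)); rewrite rho0 eta0 subr0.
have rhoE : rho t ^+ 2 = X t ^+ 2 + Y t ^+ 2 by rewrite enorm_sqr /dot -!expr2.
have rho_gt0 : 0 < rho t by rewrite enorm_gt0// -pair_eqE negb_and/= gt_eqF.
have -> : r *: dir (lo r) + t *: dir (lo r + a) = rho t *: dir (lo r + eta t).
  have sE : Num.sqrt (1 + (Y t / X t) ^+ 2) = rho t / X t.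
    have -> : 1 + (Y t / X t) ^+ 2 = (rho t / X t) ^+ 2.
      by rewrite !expr_div_n rhoE mulrDl divff// sqrf_eq0 gt_eqF.
    by rewrite sqrtr_sqr gtr0_norm// divr_gt0.
  rewrite !dirDE /dir cos_atan sin_atan sE.
  have Xn : X t != 0 by rewrite gt_eqF.
  have rn : rho t != 0 by rewrite gt_eqF.
  congr pair; rewrite /GRing.scale/= /GRing.scale/=.
    transitivity (X t * cos (lo r) - Y t * sin (lo r)); first by rewrite /X /Y; ring.
    by field; rewrite Xn rn.
  transitivity (X t * sin (lo r) + Y t * cos (lo r)); first by rewrite /X /Y; ring.
  by field; rewrite Xn rn.
apply: region_gt0 => //; first exact: ltW.
apply/andP; split; last by lra.
have sc : X t ^+ 2 + Y t ^+ 2 = r ^+ 2 + 2 * r * t * cos a + t ^+ 2.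
  rewrite /X /Y -[t ^+ 2 in RHS]mulr1 -[X in _ = _ + _ * X](cos2Dsin2 a); ring.
(* If [cos a > 0], the point lies beyond the tangent line: [rho * cos eta = X > r]. Hence [eta] is
   in absolute value less than the angle by which the lower arc has receded at distance [rho]. *)
have [ca|ca] := ltP 0 (cos a).
  have Xr : r < X t by rewrite /X ltrDl mulr_gt0.
  have rr : r < rho t.
    rewrite -(@ltr_pXn2r _ 2)// ?nnegrE ?ltW// rhoE.
    by rewrite sc; have := mulr_gt0 (mulr_gt0 r0 t0) ca; have := sqr_ge0 t; nra.
  apply: (le_lt_trans (Hr _ _)); first by rewrite !ltW.
  rewrite ltrD2l -atanN lt_atan// ltrNl.
  apply: (le_lt_trans (ler_norm _)); rewrite normrN normrM normfV (gtr0_norm Xt).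
  rewrite -[X in X < _]ger0_norm ?divr_ge0// ?(ltW Xt)// -sqrtr_sqr ltr_sqrt; last first.
    by rewrite subr_gt0 ltr_pdivlMr ?exprn_gt0// mul1r ltr_pXn2r// ?nnegrE ?ltW.
  rewrite expr_div_n real_normK ?num_real// ltr_pdivrMr ?exprn_gt0// rhoE.
  rewrite -(@ltr_pM2l _ (r ^+ 2)) ?exprn_gt0//.
  have -> : r ^+ 2 * (((X t ^+ 2 + Y t ^+ 2) / r ^+ 2 - 1) * X t ^+ 2) =
      (X t ^+ 2 + Y t ^+ 2 - r ^+ 2) * X t ^+ 2 by field; rewrite gt_eqF.
  have Xr2 : r ^+ 2 < X t ^+ 2 by rewrite ltr_pXn2r// ?nnegrE ?ltW.
  rewrite -subr_gt0.
  have -> : (X t ^+ 2 + Y t ^+ 2 - r ^+ 2) * X t ^+ 2 - r ^+ 2 * Y t ^+ 2 =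
     (X t ^+ 2 - r ^+ 2) * (X t ^+ 2 + Y t ^+ 2) by ring.
  by rewrite mulr_gt0// ?subr_gt0// -rhoE exprn_gt0.
have a3 : pi / 2 <= a.
  by rewrite leNgt; apply/negP => a3; move: ca; rewrite leNgt cos_gt0_pihalf ?a1.
pose b := a - pi / 2.
have aE : a = b + pi / 2 by rewrite /b subrK.
have b0 : 0 <= b by rewrite /b; lra.
have b1 : b < atan kappa by rewrite /b; lra.
have cb : 0 < cos b by apply: cos_gt0_pihalf; apply/andP; split; lra.
have caE : cos a = - sin b by rewrite aE cosDpihalf.
have saE : sin a = cos b by rewrite aE sinDpihalf.
have tb : sin b < kappa * cos b.
  rewrite -ltr_pdivrMr// -/(tan b) -[X in _ < X]atanK ltr_tan// in_itv/=;
  by apply/andP; split; lra.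
have Y_gt0 : 0 < Y t by rewrite /Y saE mulr_gt0.
have eta_gt0 : 0 < eta t by rewrite /eta -(atan0 R) lt_atan// divr_gt0.
have [rr|rr] := leP r (rho t).
  apply: (le_lt_trans (Hr _ _)); first by rewrite rr ltW.
  by rewrite ltrD2l (le_lt_trans _ eta_gt0)// oppr_le0 -(atan0 R) le_atan.
(* Inside the circle, the arc is above [lo r] by at most [K * (r ^ 2 - rho ^ 2)], which is at most
   [2 * K * r * t * sin b], whereas [eta] is at least [t * cos b / (2 * r)]. *)
apply: (le_lt_trans (Hl _ _)); first by rewrite !ltW.
rewrite ltrD2l rhoE sc caE.
have sb : 0 <= sin b by apply: sin_ge0_pi; rewrite b0/=; lra.
have Xr : X t <= r by rewrite /X caE mulrN gerBl mulr_ge0// ltW.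
(* From [X <= r] and [y / 2 <= y / (1 + y ^ 2) <= atan y] for [y = Y / r] in [[0, 1]]. *)
have e1 : Y t / (2 * r) <= eta t.
  have y0 : 0 <= Y t / r by rewrite divr_ge0// ltW.
  have y1 : Y t / r <= 1 by rewrite ler_pdivrMr// mul1r ltW.
  apply: (@le_trans _ _ (atan (Y t / r))); last first.
    by rewrite le_atan// ler_pM2l// lef_pV2.
  apply: le_trans (le_atan_div y0).
  rewrite invfM mulrA ler_pdivlMr; last by rewrite ltr_pwDl// sqr_ge0.
  have -> : Y t / 2 / r = Y t / r / 2 by field; rewrite gt_eqF.
  rewrite mulrAC ler_pdivrMr// ler_wpM2l//.
  by rewrite (_ : 2 = 1 + 1)// lerD2l expr_le1.
apply: lt_le_trans e1; rewrite ltr_pdivlMr ?mulr_gt0// /Y saE.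
have kb : (4 * K * r ^+ 2 + 1) * sin b < cos b.
  by rewrite -ltr_pdivlMl// -invr_gt0.
have kb' : 4 * K * r ^+ 2 * sin b < cos b by lra.
have := mulr_ge0 (mulr_ge0 K0 (ltW r0)) (sqr_ge0 t).
have : t * (4 * K * r ^+ 2 * sin b) < t * cos b by rewrite ltr_pM2l.
move=> h1 h2.
have -> : K * (r ^+ 2 - (r ^+ 2 + 2 * r * t * - sin b + t ^+ 2)) * (2 * r) =
  t * (4 * K * r ^+ 2 * sin b) - 2 * (K * r * t ^+ 2) by ring.
lra.
Unshelve. all: by end_near. Qed.

(** The mirror image of [region_lower_corner], for a side that leaves the upper arc
    counterclockwise. *)
Lemma region_upper_corner lo up r d K :
    continuous lo -> continuous up ->
    0 < r -> 0 < d -> 0 <= K -> 0 < up r - lo r < 2 * pi ->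
    (forall x, r <= x <= r + d ->
       up r + atan (Num.sqrt (x ^+ 2 / r ^+ 2 - 1)) <= up x) ->
    (forall x, r - d <= x <= r -> up r - K * (r ^+ 2 - x ^+ 2) <= up x) ->
  exists2 psi, 0 < psi < pi & forall a, - (pi / 2) < a < pi / 2 + psi ->
    \forall t \near 0^'+, 0 < region lo up (r *: dir (up r) + t *: dir (up r - a)).
Proof.
move=> clo cup r0 d0 K0 w Hr Hl.
have [||||||||psi psiI H] :=
  @region_lower_corner (fun x => - up x) (fun x => - lo x) r d K.
- by move=> x; apply: cvgN; exact: cup.
- by move=> x; apply: cvgN; exact: clo.
- by [].
- by [].
- by [].
- by rewrite opprK addrC.
- by move=> x /Hr; rewrite -opprD lerN2.
- by move=> x /Hl; rewrite -lerN2 opprB addrC.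
exists psi => // a /H; apply: filterS => t.
rewrite -[X in _ -> 0 < X]region_mirror; congr (0 < region _ _ _).
rewrite (_ : - up r + a = - (up r - a)); last by rewrite opprB addrC.
rewrite /dir !cosN !sinN; congr pair; rewrite /GRing.scale/= /GRing.scale/=; ring.
Qed.

End Region.

(** * From the analytic region to the interior and its angles *)

Section Interior.
Variables (R : realType) (N : nat) (v : 'I_N -> R * R).

(** The inward directions contain an arc of length [l]. Since they are normalised to [[0, 2 * pi[],
    an arc passing [2 * pi] is measured as two disjoint intervals. *)
Lemma interior_angle_gt_pi i (c l : R) : pi < l <= 2 * pi ->
  (forall a, c < a < c + l ->
     \forall t \near 0^'+, polygon_interior v (v i + t *: dir a)) ->
  pi < interior_angle v i.
Proof.
move=> /andP[l1 l2] H; have pi0 := pi_gt0 R.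
have [c' /andP[c0 c1] dE] := polar_exists (dir c).
have dE' : dir c = dir c'.
  by rewrite dE -[dir c]scale1r enorm_dir// scale1r.
have H' a : 0 <= a < 2 * pi -> (exists2 x, 0 < x < l & dir a = dir (c' + x)) ->
    inward_directions v i a.
  move=> aI [x /andP[x0 x1] ax]; split=> //.
  have : c < c + x < c + l by apply/andP; split; lra.
  move=> /H; rewrite [dir (c + x)](_ : _ = dir a)//.
  by rewrite ax !dirD dE'.
(* Ensures a finite measure, as [fine] sends infinite values to [0]. *)
have top : (lebesgue_measure (inward_directions v i) <= (2 * pi)%:E)%E.
  apply: (@le_trans _ _ (lebesgue_measure (`[0%R, (2 * pi)[%classic : set R))).
    by rewrite le_outer_measure// => x [xI _] /=; rewrite in_itv.
  by rewrite lebesgue_measure_itv/= lte_fin mulr_gt0// sube0.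
have bot : (l%:E <= lebesgue_measure (inward_directions v i))%E.
  have [cl|cl] := leP (c' + l) (2 * pi).
    apply: (@le_trans _ _ (lebesgue_measure (`]c', (c' + l)[%classic : set R))).
      rewrite lebesgue_measure_itv/= lte_fin ltrDl (lt_trans pi0 l1).
      by rewrite -EFinD lee_fin addrAC subrr add0r.
    rewrite le_outer_measure// => x /=; rewrite in_itv/= => /andP[x0 x1].
    apply: H'; first by apply/andP; split; lra.
    by exists (x - c'); [apply/andP; split; lra|rewrite addrC subrK].
  pose A : set R := `]c', (2 * pi)[%classic.
  pose B : set R := `[0, (c' + l - 2 * pi)[%classic.
  apply: (@le_trans _ _ (lebesgue_measure (A `|` B))).
    have AB0 : A `&` B = set0.
      rewrite -subset0 /A /B => x [] /=; rewrite !in_itv/= => /andP[x0 x1] /andP[x2 x3].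
      by lra.
    have -> : lebesgue_measure (A `|` B) = (lebesgue_measure A + lebesgue_measure B)%E.
      by apply: measureU => //; exact: measurable_itv.
    rewrite /A /B !lebesgue_measure_itv/= !lte_fin c1 subr_gt0 cl.
    by rewrite -!EFinD lee_fin; lra.
  rewrite le_outer_measure// /A /B => x [] /=; rewrite in_itv/= => /andP[x0 x1].
    apply: H'; first by apply/andP; split; lra.
    by exists (x - c'); [apply/andP; split; lra|rewrite addrC subrK].
  apply: H'; first by apply/andP; split; lra.
  exists (x - c' + 2 * pi); first by apply/andP; split; lra.
  by rewrite addrA [c' + _]addrC subrK dir2pi.
rewrite /interior_angle -lte_fin fineK.
  by apply: lt_le_trans bot; rewrite lte_fin.
rewrite fin_numE; apply/andP; split; apply/eqP => e.
  by move: bot; rewrite e leeNy_eq.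
by move: top; rewrite e leye_eq.
Qed.

(** In the complement of the boundary the set where [region] is positive is both open and closed, so
    it contains the whole component of any of its points; it is bounded because the two graphs merge
    from distance [M] on. *)
Lemma region_interior (O : R * R) (lo up : R -> R) (M : R) :
  continuous lo -> continuous up -> (forall x, M <= x -> lo x = up x) ->
  (forall p, boundary v (O + p) <-> enorm p <= M /\ region lo up p = 0) ->
  forall p, 0 < region lo up p -> polygon_interior v (O + p).
Proof.
move=> clo cup eqM bdE p rp.
pose F q := region lo up (q - O).
pose T (q : R * R) : R * R := (q.1 - O.1, q.2 - O.2).
have cT : continuous T.
  move=> q; have c1 : {for q, continuous (fun x : R * R => x.1 - O.1)}.
    by apply: cvgB; [exact: cvg_fst|exact: cvg_cst].
  have c2 : {for q, continuous (fun x : R * R => x.2 - O.2)}.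
    by apply: cvgB; [exact: cvg_snd|exact: cvg_cst].
  exact: (cvg_pair c1 c2).
have cF : continuous F.
  move=> q; apply: (continuous_comp (cT q)); exact: continuous_region.
have cE : continuous (fun q : R * R => enorm (q - O)).
  move=> q; apply: (continuous_comp (cT q)); exact: continuous_enorm.
have FE q : F (O + q) = region lo up q by rewrite /F addrAC subrr add0r.
have nb : ~ boundary v (O + p) by move=> /bdE[_ r0]; rewrite r0 ltxx in rp.
split=> //.
set C := connected_component _ _.
have CE : C `&` [set q | 0 < F q] = C.
  apply: (component_connected (A := ~` boundary v) (x := O + p)).
  - exists (O + p); split; last by rewrite /= FE.
    exact: connected_component_refl.
  - exists [set q | 0 < F q] => //.
    by apply: (@open_comp _ _ F [set y | 0 < y]) => [q _|]; [exact: cF|exact: open_gt].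
  (* A zero of [F] within distance [M] is a boundary point, so this closed set cuts out the same
     part of [C]. The bound on the norm matters: zeros farther out are not on the boundary. *)
  exists [set q : R * R | 0 <= F q /\ enorm (q - O) <= M].
    apply: closedI.
      by apply: (@preimage_closed _ _ F [set y | 0 <= y]) => [q _|];
        [exact: cF|exact: closed_ge].
    by apply: (@preimage_closed _ _ (fun q : R * R => enorm (q - O))
      [set y | y <= M]) => [q _|];
      [exact: cE|exact: closed_le].
  apply/seteqP; split=> q [Cq] /= => [Fq|[F0 qM]]; split=> //.
    by split; [exact: ltW|apply: ltW; exact: region_gt0_lt eqM Fq].
  rewrite lt_neqAle F0 andbT; apply/eqP => Fq.
  have := connected_component_sub Cq; apply.
  by rewrite -(subrK O q) addrC; apply/bdE; split=> //; rewrite -FE addrC subrK.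
exists (`|O| + M); split; first by rewrite num_real.
move=> x Mx q; rewrite -CE => -[_ /= /(region_gt0_lt eqM) qM] /=.
apply: le_trans (ltW Mx); rewrite -{1}(subrK O q).
rewrite (le_trans (ler_normD _ _))// addrC lerD2l prod_normE ge_max.
by rewrite !(le_trans (enorm_ge_coord _).1, le_trans (enorm_ge_coord _).2)// ltW.
Qed.

End Interior.

(** * The sides of an arm as a set of points *)

Section ArmSides.
Variables (R : realType) (Q : nat -> R * R) (n : nat) (phi : R).
Hypotheses (armQ : arm Q n) (Q1 : Q 1%N = enorm (Q 1%N) *: dir phi).

Definition arm_sides : set (R * R) :=
  [set p | exists k t, [/\ (k < n)%N, 0 <= t <= 1 & p = Q k + t *: (Q k.+1 - Q k)]].

Lemma arm_sidesE p : arm_sides p <->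
  enorm p <= enorm (Q n) /\ p = enorm p *: dir (arm_angle Q phi n (enorm p)).
Proof.
split=> [[k [t [kn tI ->]]]|[pn pE]]; first exact: arm_side_polar.
have pI : 0 <= enorm p <= enorm (Q n) by rewrite enorm_ge0.
have [k [t [kn tI E]]] := arm_polar_side armQ Q1 pI.
by exists k, t; split=> //; rewrite {1}pE.
Qed.

End ArmSides.

(** * Reflex angles and total turning for a lower and an upper arm *)

Section TwoArms.
Variables (R : realType) (N : nat) (v : 'I_N -> R * R) (O : R * R).
Variables (Q Q' : nat -> R * R) (n n' : nat) (phi phi' : R).
Hypotheses (armQ : arm Q n) (armQ' : arm Q' n').
Hypothesis Q1 : Q 1%N = enorm (Q 1%N) *: dir phi.
Hypothesis Q'1 : Q' 1%N = enorm (Q' 1%N) *: dir phi'.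
Hypothesis tip : Q n = Q' n'.
Hypothesis tip_angle : phi + arm_turn Q n = phi' + arm_turn Q' n'.
Hypothesis gap : forall x, 0 < x < enorm (Q n) ->
  0 < arm_angle Q' phi' n' x - arm_angle Q phi n x < 2 * pi.
Hypothesis bdE : forall p, boundary v (O + p) <-> arm_sides Q n p \/ arm_sides Q' n' p.

Let lo := arm_angle Q phi n.
Let up := arm_angle Q' phi' n'.

Let clo : continuous lo. Proof. exact: continuous_arm_angle. Qed.
Let cup : continuous up. Proof. exact: continuous_arm_angle. Qed.

Lemma two_arms_interior p : 0 < region lo up p -> polygon_interior v (O + p).
Proof.
apply: (@region_interior _ _ _ O lo up (enorm (Q n))) => //.
  move=> x nx; rewrite /lo /up (arm_angle_after armQ)//.
  by rewrite (arm_angle_after armQ') -?tip.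
move=> q; rewrite bdE (arm_sidesE armQ Q1) (arm_sidesE armQ' Q'1) -tip; split.
  case=> -[qn qE]; split=> //; rewrite qE.
    by case: (region_arc lo up (enorm_ge0 q)).
  by case: (region_arc lo up (enorm_ge0 q)).
by move=> [qn /region_eq0[]]; [left|right].
Qed.

Let norm_in k : (0 < k < n)%N -> 0 < enorm (Q k) < enorm (Q n).
Proof.
move=> /andP[k0 kn]; have kn' := ltnW kn.
rewrite (arm_norm_gt0 armQ) ?k0//= (lt_le_trans (arm_norm_lt armQ kn))//
  (arm_norm_le armQ)//.
by rewrite kn leqnn.
Qed.

Let norm_in' k : (0 < k < n')%N -> 0 < enorm (Q' k) < enorm (Q n).
Proof.
move=> /andP[k0 kn]; have kn' := ltnW kn.
rewrite (arm_norm_gt0 armQ') ?k0//= tip (lt_le_trans (arm_norm_lt armQ' kn))//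
  (arm_norm_le armQ')//.
by rewrite kn leqnn.
Qed.

Lemma lower_reflex k i : (0 < k < n)%N -> slope Q k < 0 -> v i = O + Q k ->
  pi < interior_angle v i.
Proof.
move=> kI sk vi; have /andP[k0 kn] := kI.
have /gap gk := norm_in kI; have /andP[r0 _] := norm_in kI.
have up1 := arm_norm_lt armQ kn.
have dn1 : enorm (Q k.-1) < enorm (Q k).
  by rewrite -{2}(prednK k0) (arm_norm_lt armQ)// (leq_ltn_trans _ kn)// leq_pred.
have [K K0 HK] := arm_angle_lipschitz armQ phi kI.
set r := enorm (Q k) in gk r0 up1 dn1 HK.
(* Distances within [d] of [r] involve only the two sides that meet at [Q k]. *)
pose d := Num.min (enorm (Q k.+1) - r) (r - enorm (Q k.-1)).
have d1 : d <= enorm (Q k.+1) - r by rewrite ge_min lexx.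
have d2 : d <= r - enorm (Q k.-1) by rewrite ge_min lexx orbT.
have [|||psi /andP[psi0 psi1] H] := @region_lower_corner _ lo up r d K clo cup r0 _ K0 gk.
- by rewrite lt_min !subr_gt0 up1.
- move=> x /andP[x1 x2]; rewrite /lo (arm_angle_rise armQ phi kI); last first.
    by rewrite x1/=; lra.
  by rewrite ltr0_sg// mulN1r.
- move=> x /andP[x1 x2].
  have xI : enorm (Q k.-1) <= x <= r by rewrite x2 andbT; lra.
  by rewrite -lerBlDl (le_trans (ler_norm _))// HK.
apply: (@interior_angle_gt_pi _ _ _ i (lo r - pi / 2) (pi + psi)).
  by apply/andP; split; lra.
move=> a /andP[a1 a2].
have aI : - (pi / 2) < a - lo r < pi / 2 + psi by apply/andP; split; lra.
have := H _ aI; apply: filterS => t /two_arms_interior.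
have <- : Q k = r *: dir (lo r).
  have kI' : (0 < k <= n)%N by rewrite k0 ltnW.
  by rewrite /lo /r (arm_angle_vertex armQ phi)// -(arm_vertex armQ Q1).
by rewrite addrA -vi [lo r + _]addrC subrK.
Qed.

Lemma upper_reflex k i : (0 < k < n')%N -> 0 < slope Q' k -> v i = O + Q' k ->
  pi < interior_angle v i.
Proof.
move=> kI sk vi; have /andP[k0 kn] := kI.
have /gap gk := norm_in' kI; have /andP[r0 _] := norm_in' kI.
have up1 := arm_norm_lt armQ' kn.
have dn1 : enorm (Q' k.-1) < enorm (Q' k).
  by rewrite -{2}(prednK k0) (arm_norm_lt armQ')// (leq_ltn_trans _ kn)// leq_pred.
have [K K0 HK] := arm_angle_lipschitz armQ' phi' kI.
set r := enorm (Q' k) in gk r0 up1 dn1 HK.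
pose d := Num.min (enorm (Q' k.+1) - r) (r - enorm (Q' k.-1)).
have d1 : d <= enorm (Q' k.+1) - r by rewrite ge_min lexx.
have d2 : d <= r - enorm (Q' k.-1) by rewrite ge_min lexx orbT.
have [|||psi /andP[psi0 psi1] H] := @region_upper_corner _ lo up r d K clo cup r0 _ K0 gk.
- by rewrite lt_min !subr_gt0 up1.
- move=> x /andP[x1 x2]; rewrite /up [leRHS](arm_angle_rise armQ' phi' kI); last first.
    by rewrite x1/=; lra.
  by rewrite gtr0_sg// mul1r.
- move=> x /andP[x1 x2].
  have xI : enorm (Q' k.-1) <= x <= r by rewrite x2 andbT; lra.
  by rewrite lerBlDr -lerBlDl (le_trans (ler_norm _))// distrC HK.
(* Directions are measured clockwise from [up r] here, so the excess [psi] is at the lower end of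
   the arc. *)
apply: (@interior_angle_gt_pi _ _ _ i (up r - pi / 2 - psi) (pi + psi)).
  by apply/andP; split; lra.
move=> a /andP[a1 a2].
have aI : - (pi / 2) < up r - a < pi / 2 + psi by apply/andP; split; lra.
have := H _ aI; apply: filterS => t /two_arms_interior.
have <- : Q' k = r *: dir (up r).
  have kI' : (0 < k <= n')%N by rewrite k0 ltnW.
  by rewrite /up /r (arm_angle_vertex armQ' phi')// -(arm_vertex armQ' Q'1).
by rewrite addrA -vi opprB [up r + _]addrC subrK.
Qed.

(** Close to the origin both arms are radial and the gap is [phi' - phi], which [tip_angle]
    identifies with the difference of the turns. *)
Lemma arm_turnB_le : arm_turn Q n - arm_turn Q' n' <= 2 * pi.
Proof.
have q1 : 0 < enorm (Q 1%N) by rewrite (arm_norm_gt0 armQ)//; case: armQ.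
have q'1 : 0 < enorm (Q' 1%N) by rewrite (arm_norm_gt0 armQ')//; case: armQ'.
have qn : enorm (Q 1%N) <= enorm (Q n).
  by rewrite (arm_norm_le armQ)// leqnn andbT; case: armQ.
pose x := Num.min (enorm (Q 1%N)) (enorm (Q' 1%N)) / 2.
have m0 : 0 < Num.min (enorm (Q 1%N)) (enorm (Q' 1%N)) by rewrite lt_min q1.
have m1 : Num.min (enorm (Q 1%N)) (enorm (Q' 1%N)) <= enorm (Q 1%N).
  by rewrite ge_min lexx.
have m2 : Num.min (enorm (Q 1%N)) (enorm (Q' 1%N)) <= enorm (Q' 1%N).
  by rewrite ge_min lexx orbT.
have /gap/andP[_] : 0 < x < enorm (Q n) by rewrite /x; apply/andP; split; lra.
rewrite (arm_angle_before armQ phi); last by rewrite /x; apply/andP; split; lra.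
rewrite (arm_angle_before armQ' phi'); last by rewrite /x; apply/andP; split; lra.
by have := tip_angle; lra.
Qed.

(** Up to sign the turns add up to at most [2 * pi]. Replacing a turn of the wrong sign by its
    absolute value costs twice its size, hence at most [pi], and these are the turns that produce
    reflex angles. *)
Lemma sum_turns_le :
  \sum_(1 <= k < n) `|atan (slope Q k)| + \sum_(1 <= k < n') `|atan (slope Q' k)| <=
  pi * (2 + (\sum_(1 <= k < n) (slope Q k < 0)%R +
             \sum_(1 <= k < n') (0 < slope Q' k)%R)%N%:R).
Proof.
have atan_le (s : R) : `|atan s| <= atan s + pi * (s < 0)%R%:R.
  have [s0|s0] := ltP s 0.
    have : atan s <= 0 by rewrite -(atan0 R) le_atan// ltW.
    by move=> a0; rewrite ler0_norm// mulr1; have := atan_gtNpi2 s; lra.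
  by rewrite ger0_norm ?mulr0 ?addr0// -(atan0 R) le_atan.
have le_atan' (s : R) : `|atan s| <= - atan s + pi * (0 < s)%R%:R.
  by rewrite -normrN -!atanN -oppr_lt0.
have := arm_turnB_le; rewrite /arm_turn => tB.
rewrite natrD !natr_sum.
have h1 : \sum_(1 <= k < n) `|atan (slope Q k)| <=
    \sum_(1 <= k < n) atan (slope Q k) + pi * \sum_(1 <= k < n) (slope Q k < 0)%R%:R.
  by rewrite mulr_sumr -big_split ler_sum.
have h2 : \sum_(1 <= k < n') `|atan (slope Q' k)| <=
    - \sum_(1 <= k < n') atan (slope Q' k) +
    pi * \sum_(1 <= k < n') (0 < slope Q' k)%R%:R.
  by rewrite mulr_sumr -sumrN -big_split ler_sum.
lra.
Qed.

End TwoArms.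

(** * Confining the angular gap by the intermediate value theorem *)

Section Gap.
Variable R : realType.

(** A nonpositive value would force a zero between that point and [M / 2]; a value at least [w]
    would force the value [w] on the way down to [f M = 0]. *)
Lemma gap_pos (f : R -> R) (M w : R) : continuous f -> 0 < M -> 0 < w -> f M = 0 ->
  (forall x, 0 < x < M -> f x != 0 /\ f x != w) -> 0 < f (M / 2) ->
  forall x, 0 < x < M -> 0 < f x < w.
Proof.
move=> cf M0 w0 fM H f2 x /andP[x0 xM].
have cw a b : {within `[a, b], continuous f} by exact: continuous_subspaceT.
apply/andP; split.
  rewrite ltNge; apply/negP => fx.
  have [c cI fc] : exists2 c, 0 < c < M & f c = 0.
    have [xM2|xM2] := leP x (M / 2).
      have [|c] := @IVT R f x (M / 2) 0 xM2 (cw _ _).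
        by rewrite ge_min fx le_max (ltW f2) orbT.
      by rewrite in_itv/= => /andP[c1 c2] fc; exists c => //; apply/andP; split; lra.
    have [|c] := @IVT R f (M / 2) x 0 (ltW xM2) (cw _ _).
      by rewrite ge_min fx orbT le_max (ltW f2).
    by rewrite in_itv/= => /andP[c1 c2] fc; exists c => //; apply/andP; split; lra.
  by have [+ _] := H c cI; rewrite fc eqxx.
rewrite ltNge; apply/negP => fx.
have [|c] := @IVT R f x M w (ltW xM) (cw _ _).
  by rewrite fM ge_min (ltW w0) orbT le_max fx.
rewrite in_itv/= => /andP[c1 c2] fc.
have cM : c != M by apply/eqP => e; move: fc; rewrite e fM => w1; rewrite -w1 ltxx in w0.
have cI : 0 < c < M by rewrite (lt_le_trans x0 c1) lt_neqAle cM.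
by have [_] := H c cI; rewrite fc eqxx.
Qed.

Lemma gap_sign (f : R -> R) (M w : R) : continuous f -> 0 < M -> 0 < w -> f M = 0 ->
  (forall x, 0 < x < M -> [/\ f x != 0, f x != w & f x != - w]) ->
  (forall x, 0 < x < M -> 0 < f x < w) \/ (forall x, 0 < x < M -> 0 < - f x < w).
Proof.
move=> cf M0 w0 fM H.
have M2 : 0 < M / 2 < M by apply/andP; split; lra.
have [f0|f0|f0] := ltgtP 0 (f (M / 2)).
- by left; apply: gap_pos => // x /H[].
- right; apply: (@gap_pos (fun x => - f x)) => //.
  + by move=> x; apply: cvgN; exact: cf.
  + by rewrite fM oppr0.
  + by move=> x /H[f1 f2 f3]; rewrite oppr_eq0 f1 eqr_oppLR.
  + by rewrite oppr_gt0.
- by have [] := H _ M2; rewrite -f0 eqxx.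
Qed.

End Gap.

(** * Arithmetic polygons: decomposition into arms, and estimates of the turning *)

Section Polygon.
Variables (R : realType) (N : nat) (v : 'I_N -> R * R) (o : 'I_N).
Hypothesis hP : arithmetic_polygon v o.

Let N0 : (0 < N)%N. Proof. exact: leq_ltn_trans (ltn_ord o). Qed.

(** Numbering from the distinguished vertex by all natural numbers, so that both [0] and [N] denote
    [o]. *)
Definition vidx k : 'I_N := Ordinal (ltn_pmod (o + k) N0).

Definition pos k : R * R := v (vidx k) - v o.

Lemma vidx0 : vidx 0 = o.
Proof. by apply: val_inj; rewrite /= addn0 modn_small. Qed.

Lemma vidxN : vidx N = o.
Proof. by apply: val_inj; rewrite /= modnDr modn_small. Qed.

Lemma ordS_vidx k : ordS (vidx k) = vidx k.+1.
Proof. by apply: val_inj; rewrite /= -addn1 modnDml addn1 addnS. Qed.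

Lemma vidx_inj j k : (j < N)%N -> (k < N)%N -> vidx j = vidx k -> j = k.
Proof.
move=> jN kN /(congr1 val)/eqP; rewrite /= eqn_modDl !modn_small//.
exact: eqP.
Qed.

Lemma vidx_surj i : exists2 k, (k < N)%N & i = vidx k.
Proof.
exists ((i + (N - o)) %% N)%N; first by rewrite ltn_mod.
apply: val_inj; rewrite /= modnDmr addnCA subnKC ?(ltnW (ltn_ord o))//.
by rewrite modnDr modn_small.
Qed.

Lemma pos0 : pos 0 = 0. Proof. by rewrite /pos vidx0 subrr. Qed.

Lemma posN : pos N = 0. Proof. by rewrite /pos vidxN subrr. Qed.

Lemma v_vidx k : v (vidx k) = v o + pos k.
Proof. by rewrite addrC subrK. Qed.

Lemma side_vidx k : side_vector v (vidx k) = pos k.+1 - pos k.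
Proof. by rewrite /side_vector ordS_vidx !v_vidx opprD addrACA subrr add0r. Qed.

Lemma side_point_vidx k t :
  side_point v (vidx k) t = v o + (pos k + t *: (pos k.+1 - pos k)).
Proof. by rewrite /side_point side_vidx v_vidx -addrA. Qed.

Lemma pos_simple j k (s t : R) : (j < N)%N -> (k < N)%N -> 0 <= s < 1 -> 0 <= t < 1 ->
  pos j + s *: (pos j.+1 - pos j) = pos k + t *: (pos k.+1 - pos k) -> j = k /\ s = t.
Proof.
move=> jN kN sI tI e; case: hP => /(_ (vidx j) (vidx k) s t sI tI) h _ _ _ _.
have [|/vidx_inj jk st] := h; first by rewrite !side_point_vidx e.
by rewrite jk.
Qed.

Lemma boundary_pos p : boundary v (v o + p) <->
  exists k t, [/\ (k < N)%N, 0 <= t <= 1 & p = pos k + t *: (pos k.+1 - pos k)].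
Proof.
split=> [[i [t tI]]|[k [t [kN tI ->]]]].
  have [k kN ->] := vidx_surj i; rewrite side_point_vidx => /addrI ->.
  by exists k, t.
by exists (vidx k), t => //; rewrite side_point_vidx.
Qed.

Lemma pos_inj j k : (j < N)%N -> (k < N)%N -> pos j = pos k -> j = k.
Proof.
move=> jN kN e; have := @pos_simple j k 0 0 jN kN.
by rewrite lexx ltr01 !scale0r !addr0 => /(_ isT isT e)[].
Qed.

Lemma pos_neq0 k : (0 < k < N)%N -> pos k != 0.
Proof.
move=> /andP[k0 kN]; apply/eqP => e; have := @pos_inj k 0 kN N0.
by rewrite pos0 => /(_ e) k00; rewrite k00 in k0.
Qed.

Lemma posS_neq k : (k < N)%N -> pos k.+1 != pos k.
Proof.
move=> kN; apply/eqP => e; have := @pos_simple k k 0 (1 / 2) kN kN.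
rewrite e subrr !scaler0 => /(_ _ _ erefl)[||_ /eqP]; try by apply/andP; split; lra.
by rewrite eq_sym mulf_eq0 oner_eq0 invr_eq0 pnatr_eq0.
Qed.

Lemma pos_perp k : (k < N)%N ->
  dot (pos k) (pos k.+1 - pos k) = 0 \/ dot (pos k.+1) (pos k.+1 - pos k) = 0.
Proof.
move=> kN; case: hP => _ _ _ + _ => /(_ (vidx k)).
have pl i : perp_line_through v o (vidx k) i ->
    dot (v i - v o) (pos k.+1 - pos k) = 0.
  move=> [p [d [_ + [s _ so] [t _ ti]]]]; rewrite side_vidx => d0.
  rewrite -so -ti.
  have -> (q : R * R) : dot (p + t *: d - (p + s *: d)) q = (t - s) * dot d q.
    by rewrite /dot /= /GRing.scale/= /GRing.scale/=; ring.
  by rewrite d0 mulr0.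
by rewrite ordS_vidx => -[/pl|/pl]; [left|right].
Qed.

(** Otherwise both sides at the vertex would be perpendicular to the same nonzero vector, hence
    parallel, and the vertex would be degenerate. *)
Lemma pos_corner k : (0 < k < N)%N ->
  dot (pos k) (pos k - pos k.-1) = 0 -> dot (pos k) (pos k.+1 - pos k) <> 0.
Proof.
move=> /andP[k0 kN] d1 d2; have p0 : pos k != 0 by apply: pos_neq0; rewrite k0.
have kN' : (k.-1 < N)%N by rewrite (leq_ltn_trans (leq_pred _)).
have u0 : pos k.-1 - pos k != 0.
  by have := posS_neq kN'; rewrite prednK// eq_sym subr_eq0.
have w0 : pos k.+1 - pos k != 0 by rewrite subr_eq0 posS_neq.
case: hP => _ _ _ _ /(_ (vidx k)); rewrite /vertex_angle.
have -> : ord_pred (vidx k) = vidx k.-1.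
  by rewrite -[in LHS](prednK k0) -ordS_vidx ordSK.
have vd i j : v (vidx i) - v (vidx j) = pos i - pos j.
  by rewrite !v_vidx opprD addrACA subrr add0r.
rewrite ordS_vidx !vd.
move: d1 d2 u0 w0; set u := pos k.-1 - pos k; set w := pos k.+1 - pos k.
rewrite -opprB -/u => d1 d2 u0 w0.
have uu := dot_gt0 u0; have ww := dot_gt0 w0; have pp := dot_gt0 p0.
have cr : cross u w = 0.
  apply: (mulIf (lt0r_neq0 pp)); rewrite mul0r.
  transitivity (cross (pos k) w * dot (pos k) u - cross (pos k) u * dot (pos k) w).
    by rewrite /cross /dot; ring.
  rewrite d2 mulr0 subr0 (_ : dot _ _ = - dot (pos k) (- u)).
    by rewrite d1 oppr0 mulr0.
  by rewrite /dot /=; ring.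
(* Lagrange's identity with a vanishing cross product: the cosine of the vertex angle is [1] or
   [-1]. *)
have lag : dot u w ^+ 2 = (enorm u * enorm w) ^+ 2.
  rewrite exprMn !enorm_sqr; apply/eqP; rewrite -subr_eq0.
  have -> : dot u w ^+ 2 - dot u u * dot w w = - cross u w ^+ 2.
    by rewrite /cross /dot; ring.
  by rewrite cr expr0n oppr0.
have e0 : 0 < enorm u * enorm w by rewrite mulr_gt0// enorm_gt0.
have : dot u w / (enorm u * enorm w) = 1 \/ dot u w / (enorm u * enorm w) = - 1.
  move/eqP: lag; rewrite eqf_sqr => /orP[]/eqP->; [left|right].
    by rewrite divff// gt_eqF.
  by rewrite mulNr divff// gt_eqF.
rewrite /angle => -[]->; first by rewrite acos1 eqxx => -[].
by rewrite acosN1 eqxx => -[].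
Qed.

Lemma pos_length k : (k < N)%N ->
  enorm (pos k.+1 - pos k) = side_length v o + k%:R.
Proof.
elim: k => [|k IH] kN; first by rewrite -side_vidx vidx0 addr0.
case: hP => _ _ /(_ (vidx k)) + _ _; rewrite ordS_vidx => h.
rewrite -side_vidx -/(side_length v (vidx k.+1)) h.
  by rewrite /side_length side_vidx IH ?(ltnW kN)// -natr1 addrA.
(* Since [k.+1 < N], the traversal has not returned to [o] and the recurrence on lengths applies. *)
by apply/eqP; rewrite -vidx0 => /vidx_inj; move/(_ kN N0).
Qed.

Lemma side_length_gt0 : 0 < side_length v o.
Proof.
have := pos_length N0; rewrite addr0 => <-.
by rewrite enorm_gt0// subr_eq0 posS_neq.
Qed.

(* The index of the farthest vertex: sides before it are perpendicular to the
   position vector of their first vertex, sides after it to that of their last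
   vertex, since the opposite order would make two sides collinear. *)
Lemma exists_summit : exists m, [/\ (0 < m < N)%N, arm pos m &
  arm (fun k => pos (N - k)) (N - m)].
Proof.
have ex : exists k, (k < N)%N && (dot (pos k) (pos k.+1 - pos k) != 0).
  (* The last side points straight to the origin, so it is not perpendicular to the position vector
     of its first vertex. *)
  exists N.-1; rewrite ltn_predL N0/= prednK// posN sub0r.
  have [N1|N1] := leqP N 1.
    have := posS_neq N0.
    by rewrite (_ : 1%N = N) ?posN ?pos0 ?eqxx//; apply/eqP; rewrite eqn_leq N0.
  have p0 : pos N.-1 != 0.
    by apply: pos_neq0; rewrite ltn_predL N0 andbT -ltnS prednK.
  have -> : dot (pos N.-1) (- pos N.-1) = - dot (pos N.-1) (pos N.-1).
    by rewrite /dot/=; ring.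
  by rewrite oppr_eq0 dot_eq0.
have [m /andP[mN dm] mmin] := ex_minnP ex.
have up k : (k < m)%N -> dot (pos k) (pos k.+1 - pos k) = 0.
  move=> km; apply/eqP/negPn/negP => dk; have := mmin k.
  by rewrite dk (ltn_trans km mN) => /(_ isT); rewrite leqNgt km.
have m0 : (0 < m)%N.
  rewrite lt0n; apply/eqP => e; move: dm; rewrite e pos0 /dot/=.
  by rewrite !mul0r addr0 eqxx.
(* Once a side is perpendicular to the position vector of its last vertex, [pos_corner] forces the
   same on the next side. *)
have down k : (m <= k < N)%N -> dot (pos k.+1) (pos k.+1 - pos k) = 0.
  move=> /andP[]; elim: k => [|k IH].
    by rewrite leqn0 => /eqP e; rewrite e in m0.
  rewrite leq_eqVlt => /predU1P[<- _|].
    by have [d0|//] := pos_perp mN; rewrite d0 eqxx in dm.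
  rewrite ltnS => mk kN; have dk := IH mk (ltnW kN).
  by have [/(@pos_corner k.+1 kN dk)|] := pos_perp kN.
exists m; split; first by rewrite m0.
  split=> [||k km]; [exact: pos0|exact: m0|split; first exact: up].
  by rewrite posS_neq// (ltn_trans km).
split=> [||k km]; first by rewrite subn0 posN.
  by rewrite subn_gt0.
have kN : (k < N)%N by rewrite (leq_trans km)// leq_subr.
have E : (N - k)%N = (N - k.+1).+1 by rewrite subnSK.
have jN : (N - k.+1 < N)%N by rewrite ltn_subrL.
split; last by rewrite E eq_sym posS_neq.
rewrite -[pos (N - k.+1) - _]opprB E.
have -> (p q : R * R) : dot p (- q) = - dot p q by rewrite /dot/=; ring.
rewrite down ?oppr0// jN andbT.
by move: km mN; clear; lia.
Qed.

(** The two sums run over disjoint sets of vertices: those strictly between [o] and the farthest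
    vertex [m] on either arm. *)
Lemma num_reflex_ge (m : nat) (f g : nat -> bool) : (0 < m < N)%N ->
  (forall k, (0 < k < m)%N -> f k -> pi < interior_angle v (vidx k)) ->
  (forall k, (0 < k < N - m)%N -> g k -> pi < interior_angle v (vidx (N - k))) ->
  (\sum_(1 <= k < m) f k + \sum_(1 <= k < N - m) g k <= num_reflex v)%N.
Proof.
move=> /andP[m0 mN] Hf Hg.
pose rf k : bool := pi < interior_angle v (vidx k).
have vinj : injective (fun k : 'I_N => vidx k).
  by move=> j k /(vidx_inj (ltn_ord j) (ltn_ord k)) /val_inj.
have -> : num_reflex v = (\sum_(0 <= k < N) rf k)%N.
  rewrite /num_reflex -sum1_card big_mkcond (reindex_inj vinj)/= big_mkord.
  by apply: eq_bigr => k _; rewrite inE /rf; case: ifP.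
have mN' := ltnW mN.
rewrite [leqRHS](big_cat_nat (n := m))//=.
rewrite leq_add//.
  rewrite [leqRHS]big_ltn// (leq_trans _ (leq_addl _ _))//.
  rewrite !big_nat; apply: leq_sum => k kI.
  by case fk: (f k) => //; rewrite /rf Hf.
rewrite [leqRHS]big_ltn// (leq_trans _ (leq_addl _ _))//.
rewrite [leqRHS]big_nat_rev/=.
rewrite -[m.+1]add1n [leqRHS]big_addn !big_nat; apply: leq_sum => k kI.
case gk: (g k) => //; rewrite /rf (_ : 1 + m + N - (k + m).+1 = N - k)%N ?Hg//.
by move: kI; clear; lia.
Qed.

(** Along each arm the squared distance is a sum of squared side lengths. If [2 * m <= N], the last
    [m] sides are longer than the first [m], so the second arm is, after [m] sides, already farther
    out than the vertex where both arms end. *)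
Lemma summit_past_middle m : (m < N)%N -> arm pos m ->
  arm (fun k => pos (N - k)) (N - m) -> (N < m.*2)%N.
Proof.
move=> mN armP armQ; rewrite ltnNge; apply/negP => m2.
have dP k : (k < m)%N ->
    dot (pos k.+1) (pos k.+1) = dot (pos k) (pos k) + (side_length v o + k%:R) ^+ 2.
  move=> km; rewrite (arm_pythagoras armP km); congr (_ + _).
  rewrite -enorm_sqr pos_length//.
  exact: ltn_trans mN.
have dQ k : (k < N - m)%N -> dot (pos (N - k.+1)) (pos (N - k.+1)) =
    dot (pos (N - k)) (pos (N - k)) + (side_length v o + (N - k.+1)%:R) ^+ 2.
  move=> km; have /= := arm_pythagoras armQ km.
  have E : (N - k)%N = (N - k.+1).+1 by rewrite subnSK// (leq_trans km)// leq_subr.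
  move=> ->; congr (_ + _); rewrite E -[pos (N - k.+1) - _]opprB.
  have -> (p : R * R) : dot (- p) (- p) = dot p p by rewrite /dot/= !mulrNN.
  by rewrite -enorm_sqr pos_length// ltn_subrL.
have a0 := side_length_gt0.
have lt_dot k : (k < m)%N ->
    dot (pos k.+1) (pos k.+1) < dot (pos (N - k.+1)) (pos (N - k.+1)).
  have sq j : (j < m)%N ->
     (side_length v o + j%:R) ^+ 2 < (side_length v o + (N - j.+1)%:R) ^+ 2.
    move=> jm; rewrite ltr_pXn2r// ?nnegrE ?addr_ge0 ?(ltW a0)//.
    by rewrite ltrD2l ltr_nat; move: jm mN m2; clear; lia.
  have mm : (m <= N - m)%N by move: m2; clear; lia.
  elim: k => [|k IH] km; rewrite dP// dQ ?(leq_trans km)//.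
    by rewrite subn0 posN pos0 ltrD2l sq.
  by rewrite ltrD// ?IH ?sq// ltnW.
have m0 : (0 < m)%N by case: armP.
have := lt_dot m.-1; rewrite prednK// => /(_ (leqnn _)).
have n0 : (m <= N - m)%N by move: m2; clear; lia.
rewrite -!enorm_sqr ltNge => /negP; apply.
rewrite ler_pXn2r// ?nnegrE ?enorm_ge0//.
have := @arm_norm_le _ _ _ armQ m (N - m); rewrite n0 leqnn => /(_ isT).
by rewrite subKn// ltnW.
Qed.

(* Each term is at least [atan (1 / sqrt m)], because the squared distance to the
   [k]-th vertex is a sum of [k] squares of shorter side lengths. *)
Lemma sum_turns_ge m : (m.+1 < N)%N -> arm pos m.+1 ->
  m%:R * (Num.sqrt m%:R / (1 + m%:R)) <=
  \sum_(1 <= k < m.+1) `|atan (slope pos k)|.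
Proof.
move=> mN armP; have a0 := side_length_gt0.
have [->|m0] := posnP m; first by rewrite mul0r big_geq.
have m0' : 0 < m%:R :> R by rewrite ltr0n.
have dle k : (k <= m.+1)%N ->
    dot (pos k) (pos k) <= k%:R * (side_length v o + k%:R) ^+ 2.
  elim: k => [|k IH] km; first by rewrite pos0 mul0r /dot/= mulr0 addr0.
  rewrite (arm_pythagoras armP km) -[X in _ + X]enorm_sqr pos_length; last first.
    exact: ltn_trans mN.
  have k0 : 0 <= k%:R :> R by rewrite ler0n.
  apply: (@le_trans _ _ (k.+1%:R * (side_length v o + k%:R) ^+ 2)).
    by rewrite -natr1 mulrDl mul1r lerD2r IH// ltnW.
  rewrite ler_pM2l ?ltr0n// ler_pXn2r// ?nnegrE ?addr_ge0 ?(ltW a0)//.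
  by rewrite lerD2l ler_nat.
have term k : (0 < k < m.+1)%N ->
    Num.sqrt m%:R / (1 + m%:R) <= `|atan (slope pos k)|.
  move=> kI; have /andP[k0 km] := kI.
  have pk : 0 < enorm (pos k) by rewrite (arm_norm_gt0 armP)// k0 ltnW.
  have kN : (k < N)%N by exact: ltn_trans mN.
  have sl := slope_norm armP kI; rewrite (pos_length kN) in sl.
  have s1 : (Num.sqrt m%:R)^-1 <= `|slope pos k|.
    rewrite -(ler_pM2r pk) -sl ler_pdivrMl ?sqrtr_gt0//.
    have h0 : 0 <= Num.sqrt m%:R * (side_length v o + k%:R).
      by rewrite mulr_ge0 ?sqrtr_ge0// addr_ge0 ?ler0n// ltW.
    rewrite -(@ler_pXn2r _ 2)// ?nnegrE ?enorm_ge0// enorm_sqr exprMn.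
    rewrite sqr_sqrtr ?ler0n// (le_trans (dle k (ltnW km)))//.
    by rewrite ler_wpM2r ?sqr_ge0// ler_nat -ltnS.
  have -> : `|atan (slope pos k)| = atan `|slope pos k|.
    have [s0|s0] := ltP (slope pos k) 0.
      by rewrite (ltr0_norm s0) atanN ltr0_norm// -(atan0 R) lt_atan.
    by rewrite (ger0_norm s0) ger0_norm// -(atan0 R) le_atan.
  apply: le_trans (le_atan s1).
  apply: (le_trans _ (le_atan_div _)); last by rewrite invr_ge0 sqrtr_ge0.
  have q0 : Num.sqrt m%:R != 0 :> R by rewrite gt_eqF// sqrtr_gt0.
  have E : m%:R = Num.sqrt m%:R ^+ 2 :> R by rewrite sqr_sqrtr ?ler0n.
  rewrite {2}E; set q := Num.sqrt m%:R in q0 *.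
  rewrite le_eqVlt; apply/orP; left; apply/eqP; field.
  have q1 : 1 + q ^+ 2 != 0 by rewrite gt_eqF// ltr_pwDl ?sqr_ge0.
  by rewrite q0 [q ^+ 2 + 1]addrC q1.
have -> : m%:R * (Num.sqrt m%:R / (1 + m%:R)) =
    \sum_(1 <= k < m.+1) (Num.sqrt m%:R / (1 + m%:R)) :> R.
  by rewrite sumr_const_nat subn1 mulr_natl.
by rewrite !big_nat; apply: ler_sum => k kI; exact: term.
Qed.

Lemma segment_rev (p q : R * R) (t : R) : q + (1 - t) *: (p - q) = p + t *: (q - p).
Proof.
by case: p q => a b [c d]; congr pair; rewrite /= /GRing.scale/=; ring.
Qed.

(** Side [k >= m] of the polygon is side [N - k.+1] of the second arm run backwards, with parameter
    [1 - t]. *)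
Lemma boundary_arms m : (m < N)%N -> forall p, boundary v (v o + p) <->
  arm_sides pos m p \/ arm_sides (fun k => pos (N - k)) (N - m) p.
Proof.
move=> mN p; rewrite boundary_pos; split.
  move=> [k [t [kN tI ->]]]; have [km|mk] := ltnP k m; [left|right].
    by exists k, t.
  exists (N - k.+1)%N, (1 - t); split.
  - by move: kN mk; clear; lia.
  - by apply/andP; split; lra.
  - have -> : (N - (N - k.+1) = k.+1)%N by rewrite subKn.
    have -> : (N - (N - k.+1).+1 = k)%N by rewrite subnSK// subKn// ltnW.
    by rewrite segment_rev.
case=> -[k [t [km tI ->]]]; first by exists k, t; split=> //; exact: ltn_trans mN.
have kN : (k < N)%N by rewrite (leq_trans km)// leq_subr.
have E : (N - k)%N = (N - k.+1).+1 by rewrite subnSK.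
exists (N - k.+1)%N, (1 - t); split; first by rewrite ltn_subrL.
  by apply/andP; split; lra.
rewrite -E -segment_rev; congr (_ + _ *: _); lra.
Qed.

(** Simplicity speaks of half-open sides, so a point at the end of a side is first moved to the
    start of the next one. The bounds on the norm exclude the origin and the farthest vertex, which
    the arms share. *)
Lemma arms_disjoint m : (m < N)%N -> forall p, 0 < enorm p < enorm (pos m) ->
  arm_sides pos m p -> ~ arm_sides (fun k => pos (N - k)) (N - m) p.
Proof.
move=> mN p /andP[p0 pm] s1 s2.
have [k [t [km tI pE]]] : exists k t, [/\ (k < m)%N, 0 <= t < 1 &
    p = pos k + t *: (pos k.+1 - pos k)].
  case: s1 => k [t [km /andP[t0]]]; rewrite le_eqVlt => /predU1P[->|t1 pE].
    rewrite scale1r addrC subrK => pE; exists k.+1, 0.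
    rewrite scale0r addr0 lexx ltr01; split=> //.
    rewrite ltn_neqAle km andbT; apply/eqP => e.
    by move: pm; rewrite pE e ltxx.
  by exists k, t; rewrite t0.
have [j [u [/andP[mj jN] uI]]] : exists j u, [/\ (m <= j < N)%N, 0 <= u < 1 &
    p = pos j + u *: (pos j.+1 - pos j)].
  case: s2 => j [s [jm /andP[]]]; rewrite le_eqVlt => /predU1P[<- _|s0 s1' pE'].
    rewrite scale0r addr0 => pE'; exists (N - j)%N, 0.
    rewrite scale0r addr0 lexx ltr01; split=> //; apply/andP; split.
      by move: jm mN; clear; lia.
    rewrite ltn_subrL N0 andbT lt0n; apply/eqP => e.
    by move: p0; rewrite pE' e subn0 posN enorm0 ltxx.
  have jN : (j < N)%N by rewrite (leq_trans jm)// leq_subr.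
  exists (N - j.+1)%N, (1 - s); split.
  - by move: jm mN; clear; lia.
  - by apply/andP; split; lra.
  - by rewrite pE' -segment_rev subnSK//; congr (_ + _ *: _); lra.
rewrite pE => e; have [kj _] := pos_simple (ltn_trans km mN) jN tI uI e.
by move: km; rewrite kj ltnNge mj.
Qed.

Lemma sum_turns_le_num_reflex m : (0 < m < N)%N -> arm pos m ->
  arm (fun k => pos (N - k)) (N - m) ->
  \sum_(1 <= k < m) `|atan (slope pos k)| <= pi * (2 + (num_reflex v)%:R).
Proof.
move=> mI armP armQ; have /andP[m0 mN] := mI.
have pi0 := pi_gt0 R.
set Q := fun k => pos (N - k) in armQ *.
have tip : pos m = Q (N - m)%N by rewrite /Q subKn// ltnW.
have nm0 : (0 < N - m)%N by rewrite subn_gt0.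
have M0 : 0 < enorm (pos m) by rewrite (arm_norm_gt0 armP)// m0 leqnn.
have [phi _ P1] := polar_exists (pos 1%N).
have [psi _ Qpsi] := polar_exists (Q 1%N).
(* This choice makes the two polar angles equal at the farthest vertex, not merely congruent modulo
   [2 * pi]. *)
pose phi' := phi + arm_turn pos m - arm_turn Q (N - m).
have tip_angle : phi + arm_turn pos m = phi' + arm_turn Q (N - m).
  by rewrite /phi' subrK.
(* Both arms end at the same point, so [psi] and [phi'] give the same direction. *)
have Q1 : Q 1%N = enorm (Q 1%N) *: dir phi'.
  have mm : (0 < m <= m)%N by rewrite m0 leqnn.
  have e1 := arm_vertex armP P1 mm.
  have nn : (0 < N - m <= N - m)%N by rewrite nm0 leqnn.
  have e2 := arm_vertex armQ Qpsi nn; rewrite -tip in e2.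
  have := congr1 (fun p => (enorm (pos m))^-1 *: p) (etrans (esym e2) e1).
  rewrite !scalerA mulVf ?gt_eqF// !scale1r => -[cE sE].
  rewrite {1}Qpsi; congr (_ *: _).
  rewrite -(addrK (arm_turn Q (N - m)) psi) -(addrK (arm_turn Q (N - m)) phi').
  by rewrite [LHS]dirDE [RHS]dirDE -tip_angle cE sE.
pose lo := arm_angle pos phi m; pose up := arm_angle Q phi' (N - m).
have sidesP x : 0 <= x <= enorm (pos m) -> arm_sides pos m (x *: dir (lo x)).
  by move=> /andP[x0 x1]; rewrite (arm_sidesE armP P1) enorm_dir.
have sidesQ x : 0 <= x <= enorm (pos m) -> arm_sides Q (N - m) (x *: dir (up x)).
  by move=> /andP[x0 x1]; rewrite (arm_sidesE armQ Q1) enorm_dir// -tip.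
have neq x : 0 < x < enorm (pos m) -> dir (up x) <> dir (lo x).
  move=> /andP[x0 x1] e; have xI : 0 <= x <= enorm (pos m) by rewrite !ltW.
  apply: (arms_disjoint mN _ (sidesP x xI)); first by rewrite enorm_dir ?x0// ltW.
  by rewrite -e; exact: sidesQ.
have [||||| gap|gap] := @gap_sign R (fun x => up x - lo x) (enorm (pos m)) (2 * pi).
- by move=> x; apply: cvgB; exact: continuous_arm_angle.
- by [].
- by rewrite mulr_gt0.
- rewrite /lo /up (arm_angle_after armP)// (arm_angle_after armQ) -?tip//.
  by rewrite tip_angle subrr.
- move=> x /neq h; split; apply/eqP => e; apply: h.
  + by move/eqP: e; rewrite subr_eq0 => /eqP->.
  + by rewrite -(subrK (lo x) (up x)) e addrC dir2pi.
  + by rewrite -[lo x](subrK (up x)) -opprB e opprK addrC dir2pi.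
- have bdE := boundary_arms mN.
  have := sum_turns_le armP armQ tip_angle gap.
  set S := \sum_(1 <= k < m) _; set S' := \sum_(1 <= k < N - m) _ => h.
  (* The turns of the second arm are nonnegative in absolute value and are dropped. *)
  apply: (@le_trans _ _ (S + S')); first by rewrite lerDl sumr_ge0.
  apply: (le_trans h); rewrite ler_pM2l// lerD2l ler_nat.
  apply: (num_reflex_ge (f := fun k => slope pos k < 0)
                        (g := fun k => 0 < slope Q k)) => // k kI sk.
    apply: (lower_reflex armP armQ P1 Q1 tip tip_angle gap bdE kI sk).
    exact: v_vidx.
  apply: (upper_reflex armP armQ P1 Q1 tip tip_angle gap bdE kI sk).
  exact: v_vidx.
(* In the other case the second arm is the lower one, and the roles are exchanged. *)
have gap' x : 0 < x < enorm (Q (N - m)%N) -> 0 < lo x - up x < 2 * pi.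
  by rewrite -tip => /gap; rewrite opprB.
have bdE p : boundary v (v o + p) <-> arm_sides Q (N - m) p \/ arm_sides pos m p.
  by rewrite (boundary_arms mN) or_comm.
have := sum_turns_le armQ armP (esym tip_angle) gap'.
set S' := \sum_(1 <= k < N - m) _; set S := \sum_(1 <= k < m) _ => h.
apply: (@le_trans _ _ (S' + S)); first by rewrite lerDr sumr_ge0.
apply: (le_trans h); rewrite ler_pM2l// lerD2l ler_nat addnC.
apply: (num_reflex_ge (f := fun k => 0 < slope pos k)
                      (g := fun k => slope Q k < 0)) => // k kI sk.
  apply: (upper_reflex armQ armP Q1 P1 (esym tip) (esym tip_angle) gap' bdE kI sk).
  exact: v_vidx.
apply: (lower_reflex armQ armP Q1 P1 (esym tip) (esym tip_angle) gap' bdE kI sk).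
exact: v_vidx.
Qed.

End Polygon.

(** * The bound on the number of sides *)

Unset Implicit Arguments.

Theorem theorem3p4 (R : realType) (N : nat) (v : 'I_N -> R * R) (o : 'I_N)
    (hP : arithmetic_polygon v o) (nu : R) (hnu : (num_reflex v)%:R <= nu) :
  N%:R <= 8 + 3 * pi ^+ 2 * (nu + 2) ^+ 2.
Proof.
have [[|m] [mI armP armQ]] := exists_summit hP; first by [].
have mN : (m.+1 < N)%N by case/andP: mI.
have N2 : N%:R <= 2 * m%:R + 1 :> R.
  rewrite -natrM natr1 ler_nat mul2n.
  by have := summit_past_middle hP mN armP armQ; rewrite doubleS ltnS.
have lower := sum_turns_ge hP mN armP.
have upper := sum_turns_le_num_reflex hP mI armP armQ.
have pi0 := pi_gt0 R.
set n : R := m%:R in N2 lower; have n0 : 0 <= n by rewrite ler0n.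
have nu0 : 0 <= nu by rewrite (le_trans _ hnu).
have S : n * (Num.sqrt n / (1 + n)) <= pi * (nu + 2).
  by rewrite (le_trans lower)// (le_trans upper)// ler_pM2l// addrC lerD2r.
(* Squaring removes the root of [n]. *)
have S2 : n ^+ 3 / (1 + n) ^+ 2 <= pi ^+ 2 * (nu + 2) ^+ 2.
  have -> : n ^+ 3 / (1 + n) ^+ 2 = (n * (Num.sqrt n / (1 + n))) ^+ 2.
    rewrite !exprMn exprVn sqr_sqrtr// mulrA; congr (_ * _); ring.
  have h1 : 0 <= n * (Num.sqrt n / (1 + n)).
    by rewrite mulr_ge0// divr_ge0 ?sqrtr_ge0// addr_ge0.
  have h2 : 0 <= pi * (nu + 2) :> R by apply: mulr_ge0; [exact: ltW|exact: addr_ge0].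
  by rewrite -exprMn ler_pXn2r.
(* A linear minorant suited to the goal: [2 * n + 1 = 8 + 3 * ((2 * n - 7) / 3)], and [2 * n + 1]
   bounds [N]. *)
have S3 : (2 * n - 7) / 3 <= n ^+ 3 / (1 + n) ^+ 2.
  rewrite ler_pdivlMr; last by rewrite exprn_gt0// ltr_pwDl.
  have n2 := sqr_ge0 n; have n3 : 0 <= n ^+ 3 by rewrite exprn_ge0.
  rewrite -subr_ge0.
  have -> : n ^+ 3 - (2 * n - 7) / 3 * (1 + n) ^+ 2 =
    (n ^+ 3 + 3 * n ^+ 2 + 12 * n + 7) / 3 by field.
  by rewrite divr_ge0// !addr_ge0// mulr_ge0.
lra.
Qed.
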